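(* Let $D,q,r\geq 2$ be positive integers. There exist positive constants $c,\mu_0$ such that, with high probability, for $p=cn^{-1+1/q}$ the random graph $G\sim G(n,p)$ is $r$-Ramsey for $H^q$ for every graph $H$ with $\mu_0 n$ vertices and maximum degree $D$ (that is, with probability tending to $1$ as $n\to\infty$, $G$ is simultaneously $r$-Ramsey for $H^q$ for all such graphs $H$).
   Context: A graph $G$ is $r$-Ramsey for a graph $F$, written $G\xrightarrow{}(F)_r$, if for every coloring of the edges of $G$ with $r$ colors there is a monochromatic copy of $F$ in $G$ (as a not necessarily induced subgraph). For a graph $H$, $H^q$ denotes the graph obtained from $H$ by subdividing each edge with $q-1$ new vertices, i.e. replacing each edge by a path of length $q$ (these paths being internally disjoint). $G(n,p)$ is the binomial random graph on $n$ vertices, in which each pair of vertices forms an edge independently with probability $p$. ''With high probability'' means with probability tending to $1$ as $n\to\infty$. The constants $c,\mu_0$ depend only on $D,q,r$. Floors and ceilings are omitted (so $\mu_0 n$ stands for an integer, e.g. $\lfloor \mu_0 n\rfloor$). *)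

(* Defs.v *)
From HB Require Import structures.
From mathcomp Require Import all_boot all_order all_algebra.
From mathcomp Require Import all_classical all_reals all_analysis.

Set Implicit Arguments.
Unset Strict Implicit.
Unset Printing Implicit Defensive.

Import Order.TTheory GRing.Theory Num.Theory.
Import numFieldNormedType.Exports.

Local Open Scope ring_scope.

Record sgraph := SGraph {
  vertex :> finType;
  adj : rel vertex;
  adj_sym : symmetric adj;
  adj_irr : irreflexive adj }.

Definition degree (G : sgraph) (x : G) : nat := #|[set y : G | adj x y]%SET|.

Definition max_degree (G : sgraph) : nat := (\max_(x : G) degree x)%N.

(* A colouring assigns a colour to every set of vertices; only its values on
   the edges [set x; y] of G are used. *)
Definition ramsey (G F : sgraph) (r : nat) : Prop :=
  forall col : {set G} -> 'I_r,
  exists (i : 'I_r) (f : F -> G), injective f /\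
    forall x y : F, adj x y -> adj (f x) (f y) /\ col [set f x; f y]%SET = i.

Section Subdivision.
Variables (H : sgraph) (q : nat).

(* Each edge of H is listed once, oriented along the enumeration of the
   vertices, so that its subdivision path has a first and a last endpoint. *)
Definition oriented_edge : finType :=
  {uv : H * H | adj uv.1 uv.2 && (enum_rank uv.1 < enum_rank uv.2)%N}.

Definition subdiv_vertex : finType := (H + oriented_edge * 'I_q.-1)%type.

(* The i-th vertex (0 <= i <= q) of the path of length q replacing e:
   an endpoint of e for i = 0 and i = q, the (i-1)-th new vertex otherwise. *)
Definition subdiv_path (e : oriented_edge) (i : nat) : subdiv_vertex :=
  if i is j.+1 then
    if insub j is Some k then inr (e, k) else inl (val e).2
  else inl (val e).1.

Definition subdiv_adj : rel subdiv_vertex := fun x y =>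
  [exists e : oriented_edge, exists i : 'I_q,
    ((x == subdiv_path e i) && (y == subdiv_path e i.+1)) ||
    ((y == subdiv_path e i) && (x == subdiv_path e i.+1))].

Lemma subdiv_adj_sym : symmetric subdiv_adj.
Proof.
by move=> x y; apply: eq_existsb => e; apply: eq_existsb => i; rewrite orbC.
Qed.

Lemma subdiv_path_neq (e : oriented_edge) (i : 'I_q) :
  subdiv_path e i != subdiv_path e i.+1.
Proof.
have uv : (val e).1 != (val e).2.
  by apply/eqP => eq_uv; have := valP e; rewrite eq_uv ltnn andbF.
case: i => [[|i] /= lt_iq]; first by case: insubP => [k _ _|_].
have lt_i : (i < q.-1)%N by rewrite -ltnS (ltn_predK lt_iq).
rewrite (insubT (fun j => (j < q.-1)%N) lt_i).
case: insubP => [k _ ki|_] //; apply/eqP => -[eq_k].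
by move: ki; rewrite -eq_k /= => /eqP; rewrite ltn_eqF.
Qed.

Lemma subdiv_adj_irr : irreflexive subdiv_adj.
Proof.
move=> x; apply/negbTE/negP => /existsP[e /existsP[i]].
rewrite orbb => /andP[/eqP -> /eqP eq_i].
by have := subdiv_path_neq e i; rewrite eq_i eqxx.
Qed.

Definition subdivision : sgraph := SGraph subdiv_adj_sym subdiv_adj_irr.

End Subdivision.

Section RandomGraph.
Variable n : nat.

Definition vertex_pairs : {set {set 'I_n}} := [set e : {set 'I_n} | #|e| == 2]%SET.

Definition edge_adj (E : {set {set 'I_n}}) : rel 'I_n :=
  fun x y => (x != y) && ([set x; y]%SET \in E).

Lemma edge_adj_sym E : symmetric (edge_adj E).
Proof. by move=> x y; rewrite /edge_adj eq_sym finset.setUC. Qed.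

Lemma edge_adj_irr E : irreflexive (edge_adj E).
Proof. by move=> x; rewrite /edge_adj eqxx. Qed.

Definition graph_of_edges (E : {set {set 'I_n}}) : sgraph :=
  SGraph (edge_adj_sym E) (edge_adj_irr E).

(* The probability that G(n,p) satisfies A; it is a genuine probability only
   for 0 <= p <= 1. *)
Definition gnp_prob (R : realType) (p : R) (A : sgraph -> Prop) : R :=
  \sum_(E in powerset vertex_pairs | `[< A (graph_of_edges E) >])
    \prod_(e in vertex_pairs) (if e \in E then p else 1 - p).

End RandomGraph.

(* Main.v *)
(** A vertex pair is _linked_ in a colour if it is joined by a path of length q
in that colour.  In G(n,p) every linear-sized set spans a positive proportion
(depending only on r) of pairs linked in some colour: pass to a monochromatic
subgraph of large minimum degree and grow layers around a vertex, using that
small sets expand and large sets have no overly dense pairs.  Hence, by the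
Graham-Roedl-Rucinski argument, some colour has D+1 disjoint linear-sized sets
such that the linked pairs are dense between any two large subsets of
different sets.

The branch vertices are then embedded one at a time into these sets, together
with the paths to the neighbours embedded before.  There are only about c^q
paths between two given vertices, so an embedded vertex becomes useless once
the used vertices W block many of its walks.  Such _bad_ vertices are rolled
back.  As W never shrinks, a rolled back vertex stays bad, and the number of
bad vertices is o(n) as long as W has size at most a small multiple of n, so
the process terminates after at most |H| + o(n) steps. *)

Require Import Defs.
From mathcomp Require Import all_classical all_reals all_analysis.
From mathcomp Require Import all_boot all_order all_algebra.
From mathcomp Require Import ring lra zify.

Set Implicit Arguments.
Unset Strict Implicit.
Unset Printing Implicit Defensive.

Import Order.TTheory GRing.Theory Num.Theory.
Import numFieldNormedType.Exports.

Local Open Scope set_scope.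
Local Open Scope ring_scope.

(** * Edge counts *)

(** Put t = n^(1/q) and s = n^(1-1/q), so that p n = c t and p s = c. Degrees are O(c t), and q - 1
    steps from a vertex reach only O(s) = o(n) vertices; the last step alone must produce a
    linear-sized set. Hence two kinds of upper bound on edge counts: for the early layers a union
    bound over pairs of tiny sets, for the last one a union bound over all pairs of sets, with a
    slack linear in n. Two demands on the constants pull apart. A large c is needed for the last
    step to beat the 4^n pairs of sets. But the number of ends that a good vertex may lose to the
    used vertices is about c^q times the density parameter of the used set, and it must stay below a
    fraction of n dictated by [d0], which the Graham-Roedl-Rucinski argument fixes from D, q and r.
    The order of choice is therefore [M] and [d0], then c, then the allowed number of used vertices,
    then [mu0]. *)

Section Edges.
Variable T : finType.
Implicit Types (g : rel T) (X Y A B : {set T}).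

Definition nbrs g x Y : {set T} := [set y in Y | g x y].

(* Ordered pairs: an edge inside [X :&: Y] is counted twice. *)
Definition edges g X Y : nat := (\sum_(x in X) #|nbrs g x Y|)%N.

Lemma in_nbrs g x Y y : (y \in nbrs g x Y) = (y \in Y) && g x y.
Proof. by rewrite inE. Qed.

Lemma edgesE g X Y : edges g X Y = (\sum_(x in X) \sum_(y in Y) g x y)%N.
Proof.
apply: eq_bigr => x _; rewrite -sum1_card big_mkcond [RHS]big_mkcond /=.
by apply: eq_bigr => y _; rewrite in_nbrs; case: (y \in Y); case: (g x y).
Qed.

Lemma edgesC g X Y : symmetric g -> edges g X Y = edges g Y X.
Proof.
move=> gC; rewrite !edgesE exchange_big /=.
by apply: eq_bigr => x _; apply: eq_bigr => y _; rewrite gC.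
Qed.

Lemma edgesS g X X' Y Y' :
  X \subset X' -> Y \subset Y' -> (edges g X Y <= edges g X' Y')%N.
Proof.
move=> sX sY; rewrite /edges [leqRHS](big_setID X) /= (setIidPr sX).
apply: leq_trans (leq_addr _ _); apply: leq_sum => x _; apply: subset_leq_card.
by apply/subsetP => y; rewrite !in_nbrs => /andP[/(subsetP sY) -> ->].
Qed.

Lemma edgesUl g A B Y :
  [disjoint A & B] -> edges g (A :|: B) Y = (edges g A Y + edges g B Y)%N.
Proof.
move=> dAB; rewrite /edges -bigU //=.
by apply: eq_bigl => x; rewrite !inE.
Qed.

Lemma edgesUr g A B X :
  [disjoint A & B] -> edges g X (A :|: B) = (edges g X A + edges g X B)%N.
Proof.
move=> dAB; rewrite !edgesE -big_split; apply: eq_bigr => x _.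
by rewrite -bigU //=; apply: eq_bigl => y; rewrite !inE.
Qed.

Lemma edges_leq_mul g X Y : (edges g X Y <= #|X| * #|Y|)%N.
Proof.
rewrite -sum_nat_const; apply: leq_sum => x _; apply: subset_leq_card.
by apply/subsetP => y; rewrite in_nbrs => /andP[].
Qed.

Variable R : realType.
Implicit Types d : R.

Lemma edges_le_deg g X Y (k : R) :
  (forall x, x \in X -> #|nbrs g x Y|%:R <= k) ->
  (edges g X Y)%:R <= k * #|X|%:R.
Proof.
move=> deg; rewrite /edges natr_sum mulrC mulr_natl -sumr_const.
by apply: ler_sum.
Qed.

Lemma edges_ge_deg g X Y (k : R) :
  (forall x, x \in X -> k <= #|nbrs g x Y|%:R) ->
  k * #|X|%:R <= (edges g X Y)%:R.
Proof.
move=> deg; rewrite /edges natr_sum mulrC mulr_natl -sumr_const.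
by apply: ler_sum.
Qed.

(** Markov's inequality: vertices with more than twice the allowed average degree make up at most
    half of [X]. *)
Lemma trim_half g X Y d : 0 <= d ->
  (edges g X Y)%:R <= d * #|X|%:R * #|Y|%:R ->
  exists2 X' : {set T}, X' \subset X &
    (#|X| <= 2 * #|X'|)%N /\
    forall x, x \in X' -> #|nbrs g x Y|%:R <= 2 * d * #|Y|%:R.
Proof.
move=> d0 eXY; pose X' := [set x in X | #|nbrs g x Y|%:R <= 2 * d * #|Y|%:R].
have sX' : X' \subset X by apply/subsetP => x; rewrite inE => /andP[].
exists X' => //; split; last by move=> x; rewrite inE => /andP[].
(* The final division by [d * #|Y|] fails when this is 0; then there is no edge and nothing is
   trimmed. *)
have [dY0|dY0] := leP (d * #|Y|%:R) 0.
  suff -> : X' = X by rewrite leq_pmull.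
  have e0 : edges g X Y = 0%N.
    have : (edges g X Y)%:R <= 0 :> R.
      apply: le_trans eXY _; rewrite mulrAC -[leRHS](mul0r #|X|%:R).
      by rewrite ler_wpM2r.
    by rewrite lern0 => /eqP.
  apply/setP => x; rewrite inE; case xX: (x \in X) => //=.
  move: e0; rewrite /edges => /eqP; rewrite sum_nat_eq0 => /forallP/(_ x)/implyP/(_ xX)/eqP ->.
  by rewrite mulr_ge0 // mulr_ge0.
have big : (2 * d * #|Y|%:R) * #|X :\: X'|%:R <= (edges g X Y)%:R.
  apply: le_trans (_ : (edges g (X :\: X') Y)%:R <= _).
    apply: edges_ge_deg => x; rewrite !inE negb_and => /andP[h xX].
    by move: h; rewrite xX orFb -ltNge => /ltW.
  by rewrite ler_nat edgesS // subsetDl.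
have cX : #|X|%:R = #|X'|%:R + #|X :\: X'|%:R :> R.
  by rewrite -natrD -(cardsID X' X) (setIidPr sX').
rewrite -(ler_nat R) natrM cX.
have : 2 * #|X :\: X'|%:R <= #|X|%:R :> R.
  rewrite -(ler_pM2l dY0); move: big eXY; lra.
rewrite cX; lra.
Qed.

Lemma subset_of_card X m : (m <= #|X|)%N ->
  exists2 X' : {set T}, X' \subset X & #|X'| = m.
Proof.
move=> mX; exists [set x in take m (enum X)].
  by apply/subsetP => x; rewrite inE => /mem_take; rewrite mem_enum.
rewrite cardsE (card_uniqP _) ?size_take -?cardE.
  by case: ltngtP mX.
by rewrite take_uniq ?enum_uniq.
Qed.

Lemma disjoint_subsets_of_card X k m : (k * m <= #|X|)%N ->
  exists2 V : 'I_k -> {set T},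
    forall a, V a \subset X /\ #|V a| = m &
    forall a b, a != b -> [disjoint V a & V b].
Proof.
elim: k X => [|k IHk] X kX.
  by exists (fun _ => set0) => [[]|[]] //.
have /subset_of_card[Y sY cY] : (m <= #|X|)%N by nia.
have cXY : (k * m <= #|X :\: Y|)%N by rewrite cardsD (setIidPr sY) cY; nia.
have [V V1 V2] := IHk _ cXY.
exists (fun a => if unlift ord0 a is Some b then V b else Y).
  move=> a; case: unliftP => [b _|_] //; have [sV ->] := V1 b; split=> //.
  exact: subset_trans sV (subsetDl _ _).
have dY b : [disjoint V b & Y].
  have [sV _] := V1 b; apply: disjointWl sV _.
  by rewrite -setI_eq0 setIDAC setDIl setDv setI0.
move=> a b; case: unliftP => [a' ->|->]; case: unliftP => [b' ->|->] //.
- by rewrite (inj_eq lift_inj); apply: V2.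
- by rewrite disjoint_sym dY.
Qed.

End Edges.

(** * Sparse subsets or dense tuples *)

Section Bidense.
Variable R : realType.
Implicit Types d xi tau : R.

(** Regularity from below only: candidate sets must not shrink too fast, while an excess of edges
    does no harm. *)
Definition bidense (T : finType) (g : rel T) (k : nat) d xi (v : nat)
    (V : 'I_k -> {set T}) : Prop :=
  [/\ forall a, #|V a| = v,
      forall a b, a != b -> [disjoint V a & V b] &
      forall a b (X Y : {set T}), a != b -> X \subset V a -> Y \subset V b ->
        xi * v%:R <= #|X|%:R -> xi * v%:R <= #|Y|%:R ->
        d * #|X|%:R * #|Y|%:R <= (edges g X Y)%:R].

Lemma natr_bound (x : R) : exists2 L : nat, (0 < L)%N & x <= L%:R.
Proof.
exists (Num.bound `|x|).+1 => //; apply: le_trans (ler_norm x) _.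
by apply: ltW; apply: lt_le_trans (archi_boundP (normr_ge0 x)) _; rewrite ler_nat.
Qed.

(* X is trimmed before the recursive call inside it and Y only afterwards: the
   density between the two resulting pieces is then bounded independently of
   how small they are. *)
Lemma bidense_or_sparse (k : nat) d xi (h : nat) : 0 < d -> 0 < xi ->
  exists2 M : nat, (0 < M)%N &
  forall (T : finType) (g : rel T) (U : {set T}) (w : nat),
    symmetric g -> (M * w <= #|U|)%N ->
    (exists v V, (w <= v)%N /\ @bidense T g k d xi v V) \/
    (exists2 S : {set T}, S \subset U & #|S| = (2 ^ h * w)%N /\
       (edges g S S)%:R <= ((2 ^+ h)^-1 + 4 * d) * #|S|%:R ^+ 2).
Proof.
move=> d0 xi0; elim: h => [|h [M M0 IH]].
  exists 1%N => // T g U w gC; rewrite mul1n => /subset_of_card[S sS cS].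
  right; exists S => //; split; first by rewrite cS.
  apply: le_trans (_ : #|S|%:R ^+ 2 <= _).
    by rewrite expr2 -natrM ler_nat edges_leq_mul.
  rewrite ler_peMl ?sqr_ge0 // expr0 invr1; lra.
(* [L] makes [xi * v] at least [2 * (M * w)], so a witness of failed bidensity still has [M * w]
   vertices after being trimmed to half. *)
have [L L0 xiL] := natr_bound (2 / xi).
exists (k.+1 * (L * M))%N; first by rewrite !muln_gt0 L0 M0.
move=> T g U w gC; rewrite -mulnA => wU.
have {wU} : (k * (L * M * w) <= #|U|)%N.
  by apply: leq_trans wU; rewrite leq_mul2r leqnSn orbT.
set v := (L * M * w)%N => /disjoint_subsets_of_card[V V1 V2].
have [bd|nbd] := pselect (bidense g d xi v V).
  by left; exists v, V; split=> //; rewrite leq_pmull // muln_gt0 L0.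
have Mv : 2 * (M * w)%:R <= xi * v%:R :> R.
  rewrite /v -mulnA [in leRHS]natrM mulrA ler_wpM2r ?ler0n //.
  by rewrite mulrC -ler_pdivrMr.
have [a [b [X [Y [ab sX sY [cX cY] eXY]]]]] : exists a b (X Y : {set T}),
   [/\ a != b, X \subset V a, Y \subset V b,
     xi * v%:R <= #|X|%:R /\ xi * v%:R <= #|Y|%:R &
     (edges g X Y)%:R <= d * #|X|%:R * #|Y|%:R].
  apply: contrapT => none; apply: nbd; split=> //; first by move=> a; case: (V1 a).
  move=> a b X Y ab sX sY cX cY; apply: ltW; rewrite ltNge; apply/negP => eXY.
  by apply: none; exists a, b, X, Y; split=> //; apply: ltW.
have [X' sX' [cX' dX']] := trim_half (ltW d0) eXY.
have half (Z Z' : {set T}) : xi * v%:R <= #|Z|%:R -> (#|Z| <= 2 * #|Z'|)%N ->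
    (M * w <= #|Z'|)%N.
  move=> cZ cZ'; rewrite -(leq_pmul2l (isT : 0 < 2)%N); apply: leq_trans cZ'.
  by rewrite -(ler_nat R); apply: le_trans cZ; rewrite natrM.
have [[v' [V' [wv bd]]]|[A sA [cA eA]]] := IH T g X' w gC (half _ _ cX cX').
  by left; exists v', V'.
have eYA : (edges g Y A)%:R <= 2 * d * #|Y|%:R * #|A|%:R :> R.
  rewrite edgesC //; apply: edges_le_deg => x /(subsetP sA) /dX'.
  by [].
have [Y' sY' [cY' dY']] := trim_half (mulr_ge0 (ler0n _ 2) (ltW d0)) eYA.
have [[v' [V' [wv bd]]]|[B sB [cB eB]]] := IH T g Y' w gC (half _ _ cY cY').
  by left; exists v', V'.
have eBA : (edges g B A)%:R <= 2 * (2 * d) * #|A|%:R * #|B|%:R :> R.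
  by apply: edges_le_deg => x /(subsetP sB); exact: dY'.
have [sXU sYU] : X \subset U /\ Y \subset U.
  split; [apply: subset_trans sX _|apply: subset_trans sY _].
    by case: (V1 a).
  by case: (V1 b).
have dAB : [disjoint A & B].
  apply: disjointWl (subset_trans sA (subset_trans sX' sX)) _.
  by apply: disjointWr (subset_trans sB (subset_trans sY' sY)) (V2 _ _ ab).
have cAB : #|A :|: B| = (#|A| + #|B|)%N.
  by rewrite cardsU (disjoint_setI0 dAB) cards0 subn0.
right; exists (A :|: B); last split.
- by rewrite subUset !(subset_trans sA, subset_trans sB, subset_trans sX', subset_trans sY').
- by rewrite cAB cA cB addnn -mul2n expnS mulnA.
(* Each diagonal block is a quarter of the square, which halves the term [(2 ^+ h)^-1]; the cross
   blocks have density at most [4 * d], so that term reproduces itself. *)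
- rewrite edgesUl // !edgesUr // (edgesC A B gC) cAB.
  rewrite cA cB; move: eA eB eBA; rewrite cA cB [2 ^+ h.+1]exprS invfM.
  rewrite !natrD; set z := (2 ^ h * w)%:R; set i := (_ ^+ h)^-1.
  lra.
Qed.

(* [xi] is a function of the density so that the regularity scale can be
   chosen after it. *)
Lemma bidense_or_sparse_all (k r : nat) (delta : R) (xi : R -> R) :
  0 < delta -> (forall d, 0 < d -> 0 < xi d) ->
  exists (M : nat) (d0 : R), [/\ (0 < M)%N, 0 < d0 &
  forall (T : finType) (g : nat -> rel T) (U : {set T}) (w : nat),
    (forall i, symmetric (g i)) -> (M * w <= #|U|)%N ->
    (exists i d v V, [/\ (i < r)%N, d0 <= d <= 1, (w <= v)%N &
       @bidense T (g i) k d (xi d) v V]) \/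
    (exists2 S : {set T}, S \subset U & (w <= #|S|)%N /\
       forall i, (i < r)%N -> (edges (g i) S S)%:R <= delta * #|S|%:R ^+ 2)].
Proof.
move=> delta0 xi0; elim: r => [|r [M [d0 [M0 d00 IH]]]].
  exists 1%N, 1; split=> // T g U w gC; rewrite mul1n => wU.
  by right; exists U.
(* The set found for the other colours keeps at least a fraction 1/M of [S], so density [tau] of the
   last colour on [S] becomes at most [tau * M^2 <= delta]. The choices of [d] and [h] split [tau]
   as [tau / 2 + 4 * (tau / 8)]. *)
pose tau := Num.min 1 (delta / M%:R ^+ 2).
have M0' : 0 < M%:R :> R by rewrite ltr0n.
have tau0 : 0 < tau by rewrite lt_min ltr01 divr_gt0 // exprn_gt0.
pose d := tau / 8.
have dd0 : 0 < d by rewrite divr_gt0.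
have d1 : d <= 1.
  have : tau <= 1 by rewrite ge_min lexx.
  by rewrite /d; lra.
have [h _ hh] := natr_bound (2 / tau).
have hpow : (2 ^+ h)^-1 <= tau / 2.
  rewrite -[leRHS]invrK lef_pV2 ?posrE ?invr_gt0 ?exprn_gt0 ?divr_gt0 //.
  rewrite invf_div; apply: le_trans hh _.
  by rewrite -natrX ler_nat ltnW // ltn_expl.
have [Mh Mh0 step] := bidense_or_sparse k h dd0 (xi0 _ dd0).
exists (Mh * M)%N, (Num.min d0 d); split; first by rewrite muln_gt0 Mh0.
  by rewrite lt_min d00.
move=> T g U w gC; rewrite -mulnA => wU.
have [[v [V [wv bd]]]|[S sS [cS eS]]] := step T (g r) U _ (gC r) wU.
  left; exists r, d, v, V; split=> //; first by rewrite ge_min lexx orbT.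
  by apply: leq_trans wv; rewrite leq_pmull.
have wS : (M * (2 ^ h * w) <= #|S|)%N by rewrite cS mulnCA mulnA.
have [[i [d' [v [V [ir dd wv bd]]]]]|[S' sS' [cS' eS']]] := IH T g S _ gC wS.
  left; exists i, d', v, V; split=> //; first exact: ltnW.
    by case/andP: dd => dd ->; rewrite ge_min dd.
  by apply: leq_trans wv; rewrite leq_pmull // expn_gt0.
right; exists S'; first exact: subset_trans sS' sS.
split; first by apply: leq_trans cS'; rewrite leq_pmull // expn_gt0.
move=> i; rewrite ltnS leq_eqVlt => /predU1P[->|/eS' //].
apply: le_trans (_ : (edges (g r) S S)%:R <= _); first by rewrite ler_nat edgesS.
apply: le_trans eS _; apply: le_trans (_ : tau * #|S|%:R ^+ 2 <= _).
  by rewrite ler_wpM2r ?sqr_ge0 //; move: hpow; rewrite /d; lra.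
have SS' : #|S|%:R <= M%:R * #|S'|%:R :> R.
  by rewrite -natrM ler_nat cS mulnCA leq_mul2l cS' orbT.
apply: le_trans (_ : tau * (M%:R * #|S'|%:R) ^+ 2 <= _).
  by rewrite ler_wpM2l ?(ltW tau0) // ler_sqr ?nnegrE ?mulr_ge0.
rewrite exprMn mulrA ler_wpM2r ?sqr_ge0 // -ler_pdivlMr ?exprn_gt0 //.
by rewrite ge_min lexx orbT.
Qed.

End Bidense.

(** * Walks and blocked vertices *)

Section Walks.
Variable T : finType.
Implicit Types (g : rel T) (u x : T) (w : nat -> T) (W : {set T}).

Definition walk g (l : nat) u x w : Prop :=
  [/\ w 0%N = u, w l = x & forall i, (i < l)%N -> g (w i) (w i.+1)].

Definition spath g (l : nat) u x w : Prop :=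
  walk g l u x w /\
  forall i j, (i <= l)%N -> (j <= l)%N -> w i = w j -> i = j.

Definition linked g (l : nat) : rel T :=
  fun u x => `[< exists w, spath g l u x w >].

Definition inner (l : nat) w : {set T} := [set w i | i : 'I_l & (0 < i)%N].

Lemma innerP l w x :
  reflect (exists2 i, (0 < i < l)%N & x = w i) (x \in inner l w).
Proof.
apply: (iffP imsetP) => [[i]|[i /andP[i0 il] ->]].
  by rewrite inE => i0 ->; exists (val i) => //; rewrite i0 ltn_ord.
by exists (Ordinal il); rewrite ?inE.
Qed.

Lemma card_inner l w : (#|inner l w| <= l)%N.
Proof.
by apply: leq_trans (leq_imset_card _ _) _; rewrite -[leqRHS]card_ord max_card.
Qed.

Lemma inner_rev l w : inner l (fun i => w (l - i)%N) = inner l w.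
Proof.
apply/setP => x; apply/innerP/innerP => -[i /andP[i0 il] ->].
  by exists (l - i)%N => //; apply/andP; lia.
by exists (l - i)%N; [apply/andP; lia|rewrite subKn // ltnW].
Qed.

Lemma spath_rev g l u x w : symmetric g ->
  spath g l u x w -> spath g l x u (fun i => w (l - i)%N).
Proof.
move=> gC [[w0 wl wg] wI]; split; last first.
  move=> i j il jl /wI; rewrite !leq_subr => /(_ isT isT); lia.
split; rewrite ?subn0 ?subnn // => i il.
by rewrite gC -[in X in g _ X](subnSK il) wg // ltn_subrL; lia.
Qed.

Lemma linked_sym g l : symmetric g -> symmetric (linked g l).
Proof.
move=> gC u x; apply/asboolP/asboolP => -[w] /(spath_rev gC) ww;
  by eexists; exact: ww.
Qed.

Lemma walk_sub g g' l u x w : subrel g g' -> walk g l u x w -> walk g' l u x w.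
Proof. by move=> sg [w0 wl wg]; split=> // i /wg /sg. Qed.

Variables (g : rel T) (q : nat).

(** All walks of the whole graph count, not only paths of one colour: a vertex outside this set is
    safe whichever path to it is chosen, and bounding the set takes only edge counts in [g]. *)
Definition hit u W : {set T} :=
  [set x | `[< exists2 w, walk g q u x w & ~~ [disjoint inner q w & W] >]].

Definition bad (e : nat) W : {set T} := [set u | (e < #|hit u W|)%N].

(* If x avoids this set then every walk from u1 to x is internally disjoint from
   every walk from u2 to x, so the paths to x can be chosen arbitrarily. *)
Definition conflict u1 u2 : {set T} :=
  [set x | `[< exists w1 w2, [/\ walk g q u1 x w1, walk g q u2 x w2 &
                 ~~ [disjoint inner q w1 & inner q w2]] >]].

Definition reach u : {set T} :=
  [set z | `[< exists l w, (0 < l < q)%N /\ walk g l u z w >]].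

Lemma hitS u W W' : W \subset W' -> hit u W \subset hit u W'.
Proof.
move=> sW; apply/subsetP => x; rewrite !inE => /asboolP[w ww dw].
apply/asboolP; exists w => //; apply: contra dw => dw; exact: disjointWr sW dw.
Qed.

Lemma badS e W W' : W \subset W' -> bad e W \subset bad e W'.
Proof.
move=> sW; apply/subsetP => u; rewrite !inE => /leq_trans; apply.
exact/subset_leq_card/hitS.
Qed.

Lemma conflictC u1 u2 : conflict u1 u2 = conflict u2 u1.
Proof.
apply/setP => x; rewrite !inE; apply/asboolP/asboolP => -[w1 [w2 [ww1 ww2 dw]]];
  by exists w2, w1; split=> //; rewrite disjoint_sym.
Qed.

(** Makes conflicts a case of blocking: a vertex [u2] outside [bad e (reach u1)] has at most [e]
    conflicts with [u1], so the bound on bad vertices also covers conflicts. *)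
Lemma conflict_hit u1 u2 : conflict u1 u2 \subset hit u2 (reach u1).
Proof.
apply/subsetP => x; rewrite !inE => /asboolP[w1 [w2 [[w10 _ w1g] ww2 dw]]].
apply/asboolP; exists w2 => //; apply: contra dw => dw.
rewrite disjoint_sym; apply: disjointWr dw; apply/subsetP => z.
case/innerP => i iq ->; rewrite inE; apply/asboolP; exists i, w1.
split=> //; split=> // j ji; apply: w1g; lia.
Qed.

Lemma card_bigcup_sum (I : finType) (A : {set I}) (B : I -> {set T}) :
  (#|\bigcup_(i in A) B i| <= \sum_(i in A) #|B i|)%N.
Proof.
rewrite -(big_enum _ _ A (fun i => B i)) -(big_enum _ _ A (fun i => #|B i|)) /=.
elim: (enum A) => [|i s IHs]; first by rewrite !big_nil cards0.
rewrite !big_cons; apply: leq_trans (leq_card_setU _ _) _.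
by rewrite leq_add2l.
Qed.

Lemma card_bigcup_le (R : realType) (I : finType) (A : {set I})
    (B : I -> {set T}) (m : R) :
  (forall i, i \in A -> #|B i|%:R <= m) ->
  #|\bigcup_(i in A) B i|%:R <= #|A|%:R * m.
Proof.
move=> Bm; rewrite mulr_natl -[leRHS]sumr_const.
apply: le_trans (_ : \sum_(i in A) #|B i|%:R <= _); last by apply: ler_sum.
by rewrite -natr_sum ler_nat card_bigcup_sum.
Qed.

Lemma leq_card_bigcup (I : finType) (A : {set I}) (B : I -> {set T}) (m l : nat) :
  (#|A| <= m)%N -> (forall i, i \in A -> (#|B i| <= l)%N) ->
  (#|\bigcup_(i in A) B i| <= m * l)%N.
Proof.
move=> cA cB; apply: leq_trans (card_bigcup_sum _ _) _.
apply: leq_trans (_ : #|A| * l <= _)%N; last by rewrite leq_mul2r cA orbT.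
by rewrite -sum_nat_const leq_sum.
Qed.

End Walks.

(** * Monochromatic paths in linear-sized sets *)

Section MonochromaticPaths.
Variables (R : realType) (T : finType).
Implicit Types (g : rel T) (S X Y L : {set T}) (mu : R).

(** A subset maximising edges minus [2 * mu] per vertex works: as edges are ordered pairs, deleting
    a vertex of degree below [mu] loses less than [2 * mu] of them and would increase the value. *)
Lemma min_degree_subset g S mu : symmetric g -> 0 <= mu ->
  2 * mu * #|S|%:R < (edges g S S)%:R ->
  exists2 S' : {set T}, S' \subset S & S' != set0 /\
    forall x, x \in S' -> mu <= #|nbrs g x S'|%:R.
Proof.
move=> gC mu0 eS.
pose F X : R := (edges g X X)%:R - 2 * mu * #|X|%:R.
have [S' sS' maxS'] := @arg_maxP _ R _ S (fun X => X \subset S) F (subxx S).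
have FS : 0 < F S' by apply: lt_le_trans (maxS' S (subxx S)); rewrite subr_gt0.
exists S' => //; split.
  apply: contraTneq FS => ->; rewrite /F /edges big_set0 cards0; lra.
move=> x xS'; rewrite leNgt; apply/negP => small.
have : F (S' :\ x) <= F S' := maxS' _ (subset_trans (subD1set _ _) sS').
rewrite leNgt => /negP; apply.
have dx : [disjoint [set x] & S' :\ x].
  by rewrite disjoints1 !inE eqxx.
have cS' : #|S'| = #|S' :\ x|.+1 by rewrite (cardsD1 x) xS'.
have : (edges g S' S' <= edges g (S' :\ x) (S' :\ x) + 2 * #|nbrs g x S'|)%N.
  rewrite -{1 2}(setD1K xS') edgesUl // !edgesUr // (edgesC (S' :\ x) [set x] gC).
  have e1 Y : edges g [set x] Y = #|nbrs g x Y| by rewrite /edges big_set1.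
  have := edgesUr g [set x] dx; rewrite (setD1K xS') !e1; lia.
rewrite -(ler_nat R) [in X in _ -> X]/F natrD natrM => le_e.
by rewrite cS' -natr1; move: small le_e; lra.
Qed.

Lemma spath_extend g l u x y (w : nat -> T) L :
  spath g l u x w -> (forall i, (i <= l)%N -> w i \in L) -> g x y -> y \notin L ->
  spath g l.+1 u y (fun i => if (i <= l)%N then w i else y).
Proof.
move=> [[w0 wl wg] wI] wL xy yL; split; last first.
  move=> i j il jl; case: leqP => il'; case: leqP => jl' wij.
  - exact: wI.
  - by rewrite -wij wL in yL.
  - by rewrite wij wL in yL.
  - lia.
split=> //; first by rewrite ltnn.
move=> i; rewrite ltnS => il; rewrite /= il; case: ltnP => il'; first exact: wg.
have -> : i = l by lia.
by rewrite wl.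
Qed.

(** Layers of exactly [m ^ j] vertices are grown around a vertex in the most frequent colour.
    Minimum degree forces many edges from a layer to its neighbourhood; by [small] that
    neighbourhood cannot be tiny, and by [large] the one of the last layer has linear size. *)
Lemma mono_paths_dense (g : rel T) (gi : nat -> rel T) (r q m z : nat) S mu :
  (forall i, symmetric (gi i)) -> (forall i, subrel (gi i) g) ->
  (forall x y, g x y -> exists2 i, (i < r)%N & gi i x y) ->
  (2 <= q)%N -> (2 <= m)%N -> 0 < mu ->
  4 * r%:R * mu * #|S|%:R < (edges g S S)%:R ->
  (forall j X Y, (j < q.-1)%N -> #|X| = (m ^ j)%N -> (#|Y| <= 2 * m ^ j.+1)%N ->
     (edges g X Y)%:R < mu * #|X|%:R) ->
  (forall X Y, #|X| = (m ^ q.-1)%N -> mu * #|X|%:R <= (edges g X Y)%:R ->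
     (z + 2 * m ^ q.-1 <= #|Y|)%N) ->
  exists2 i, (i < r)%N & (z * z <= edges (linked (gi i) q) S S)%N.
Proof.
move=> giC gig gcol q2 m2 mu0 eS small large.
have [i ir eiS] : exists2 i, (i < r)%N & 4 * mu * #|S|%:R < (edges (gi i) S S)%:R.
  apply: contrapT => none; move: eS; apply/negP; rewrite -leNgt.
  apply: le_trans (_ : (\sum_(i < r) edges (gi i) S S)%:R <= _).
    rewrite ler_nat /edges exchange_big leq_sum //= => x _.
    apply: leq_trans (_ : #|\bigcup_(i in [set: 'I_r]) nbrs (gi i) x S| <= _)%N.
      apply/subset_leq_card/subsetP => y; rewrite in_nbrs => /andP[yS /gcol[i ir xy]].
      by apply/bigcupP; exists (Ordinal ir); rewrite ?inE // yS.
    apply: leq_trans (card_bigcup_sum _ _) _; apply: eq_leq.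
    by apply: eq_bigl => y; rewrite inE.
  rewrite natr_sum; apply: le_trans (_ : \sum_(i < r) (4 * mu * #|S|%:R) <= _).
    apply: ler_sum => j _; rewrite leNgt; apply/negP => ej.
    by apply: none; exists j; first exact: ltn_ord.
  by rewrite sumr_const card_ord -mulr_natr; lra.
have mu2 : 0 <= 2 * mu by rewrite mulr_ge0 // ltW.
have eiS' : 2 * (2 * mu) * #|S|%:R < (edges (gi i) S S)%:R by move: eiS; lra.
have [S' sS' [S'0 degS']] := min_degree_subset (giC i) mu2 eiS'.
have {}degS' x : x \in S' -> mu <= #|nbrs (gi i) x S'|%:R.
  by move=> /degS'; lra.
pose N X := [set y in S' | [exists x in X, gi i x y]].
(* Here the colour is forgotten: edges of one colour bound those of [g] from below, and [small] and
   [large] speak of [g]. *)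
have eN X : X \subset S' -> mu * #|X|%:R <= (edges g X (N X))%:R.
  move=> sX; apply: le_trans (_ : (edges (gi i) X S')%:R <= _).
    by apply: edges_ge_deg => x /(subsetP sX); exact: degS'.
  rewrite ler_nat; apply: leq_sum => x xX; apply/subset_leq_card/subsetP => y.
  rewrite !inE => /andP[-> xy] /=; rewrite (gig _ _ _ xy) andbT.
  by apply/exists_inP; exists x.
have layers u j : u \in S' -> (j < q)%N -> exists X L,
    [/\ X \subset L, L \subset S', #|X| = (m ^ j)%N, (#|L| <= 2 * m ^ j)%N &
      forall x, x \in X -> exists2 w, spath (gi i) j u x w &
        forall l, (l <= j)%N -> w l \in L].
  move=> uS'; elim: j => [|j IHj] jq.
    exists [set u], [set u]; rewrite cards1 !sub1set inE eqxx; split=> // x.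
    rewrite inE => /eqP ->; exists (fun=> u); last by move=> l _; rewrite inE.
    by split=> // k l; rewrite !leqn0 => /eqP -> /eqP ->.
  have [X [L [sX sL cX cL XL]]] := IHj (ltnW jq).
  have cN : (2 * m ^ j.+1 < #|N X|)%N.
    rewrite ltnNge; apply/negP => cN; have j1 : (j < q.-1)%N by move: jq; clear; lia.
    by have := small j X (N X) j1 cX cN; rewrite ltNge eN ?(subset_trans sX).
  (* Keeping the new layer outside [L] makes the extended walk a path. As [2 <= m], [L] has at most
     [m ^ j.+1] vertices, so enough of [N X] remains. *)
  have [X' sX' cX'] : exists2 X' : {set T}, X' \subset N X :\: L & #|X'| = (m ^ j.+1)%N.
    apply: subset_of_card; have := subset_leq_card (subsetIr (N X) L).
    have : (2 * m ^ j <= m ^ j.+1)%N by rewrite expnS leq_mul2r m2 orbT.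
    rewrite cardsD; move: cN cL; set n1 := (m ^ j.+1)%N; set n2 := (m ^ j)%N; clear; lia.
  exists X', (X' :|: L); split=> //.
  - exact: subsetUl.
  - rewrite subUset sL andbT; apply: subset_trans sX' _.
    by apply/subsetP => y; rewrite !inE => /andP[_ /andP[]].
  - apply: leq_trans (leq_card_setU _ _) _; rewrite cX'.
    have : (2 * m ^ j <= m ^ j.+1)%N by rewrite expnS leq_mul2r m2 orbT.
    move: cL; set n1 := (m ^ j.+1)%N; set n2 := (m ^ j)%N; clear; lia.
  - move=> y yX'; move: (subsetP sX' _ yX'); rewrite !inE => /andP[yL].
    move=> /andP[_ /exists_inP[x xX xy]]; have [w ww wL] := XL x xX.
    exists (fun l => if (l <= j)%N then w l else y).
      exact: spath_extend ww wL xy yL.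
    by move=> l lj; rewrite inE; case: leqP => [/wL ->|_]; rewrite ?orbT ?yX'.
have q1 : (q.-1 < q)%N by lia.
have reachable u : u \in S' -> (z <= #|nbrs (linked (gi i) q) u S'|)%N.
  move=> uS'; have [X [L [sX sL cX cL XL]]] := layers u q.-1 uS' q1.
  have cN := large X (N X) cX (eN X (subset_trans sX sL)).
  apply: leq_trans (_ : #|N X :\: L| <= _)%N.
    have := subset_leq_card (subsetIr (N X) L); rewrite cardsD.
    by move: cN cL; clear; lia.
  apply/subset_leq_card/subsetP => y; rewrite in_nbrs inE => /andP[yL].
  rewrite inE => /andP[-> /exists_inP[x xX xy]]; have [w ww wL] := XL x xX.
  apply/asboolP; exists (fun l => if (l <= q.-1)%N then w l else y).
  by have := spath_extend ww wL xy yL; rewrite prednK // ltnW.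
have zS' : (z <= #|S'|)%N.
  have /set0Pn[u uS'] := S'0; apply: leq_trans (reachable u uS') _.
  by apply/subset_leq_card/subsetP => y; rewrite inE => /andP[].
exists i => //; apply: leq_trans (edgesS _ sS' sS').
apply: leq_trans (_ : #|S'| * z <= _)%N; first by rewrite leq_mul2r zS' orbT.
by rewrite -sum_nat_const leq_sum.
Qed.

End MonochromaticPaths.

(** * Embedding with rollback *)

(** The class of a branch vertex decides which of the [D.+1] bidense sets receives it, so adjacent
    branch vertices go to different sets. *)
Lemma greedy_coloring (H : sgraph) (D : nat) :
  (forall v : H, degree v <= D)%N ->
  exists chi : H -> 'I_D.+1, forall u v : H, adj u v -> chi u != chi v.
Proof.
move=> degD; suff main : forall A : {set H}, exists chi : H -> 'I_D.+1,
    {in A &, forall u v, adj u v -> chi u != chi v}.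
  by have [chi chiP] := main setT; exists chi => u v; apply: chiP; rewrite inE.
move=> A; move: {2}#|A| (erefl #|A|) => m; elim: m A => [|m IHm] A cA.
  by exists (fun=> ord0) => u; rewrite (cards0_eq cA) inE.
have [v vA] : exists v, v \in A by apply/set0Pn; rewrite -card_gt0 cA.
have [chi chiP] : exists chi : H -> 'I_D.+1,
    {in A :\ v &, forall u v, adj u v -> chi u != chi v}.
  by apply: IHm; move: cA; rewrite (cardsD1 v) vA => -[].
pose used := [set chi w | w in nbrs (@adj H) v setT].
have /subsetPn[c _ cF] : ~~ ([set: 'I_D.+1] \subset used).
  apply/negP => /subset_leq_card; rewrite cardsT card_ord leqNgt ltnS => /negP; apply.
  apply: leq_trans (leq_imset_card _ _) _; apply: leq_trans (degD v).
  by apply: subset_leq_card; apply/subsetP => w; rewrite !inE.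
have usedP w : adj v w -> chi w != c.
  by move=> vw; apply: contraNneq cF => <-; apply/imsetP; exists w; rewrite ?inE.
exists (fun w => if w == v then c else chi w) => u w uA wA uw.
have [eu|nu] := eqVneq u v; have [ew|nw] := eqVneq w v.
- by move: uw; rewrite eu ew adj_irr.
- by rewrite eq_sym usedP // -eu.
- by rewrite usedP // -ew adj_sym.
- by apply: chiP; rewrite // !inE ?nu ?nw.
Qed.

Section Embedding.
Variables (R : realType) (T : finType) (g gi : rel T) (q : nat).
Variables (H : sgraph) (D k : nat) (chi : H -> 'I_k) (V : 'I_k -> {set T}).
Variables (d xi : R) (v0 a b e : nat).
Implicit Types (u v w z : H) (x y : T) (A : {set H}) (f : H -> T).
Implicit Types (P : H -> H -> nat -> T) (W : {set T}).

Hypothesis giC : symmetric gi.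
Hypothesis gig : subrel gi g.
Hypothesis degD : forall v, (degree v <= D)%N.
Hypothesis chiP : forall u v, adj u v -> chi u != chi v.
Hypothesis bd : bidense (linked gi q) d xi v0 V.
Hypothesis d01 : 0 < d <= 1.
Hypothesis card_bad : forall W, (#|W| <= a)%N -> (#|bad g q e W| <= b)%N.
Hypothesis card_reach : forall x, (#|reach g q x| <= a)%N.
Hypothesis xi0 : 0 <= xi.
Hypothesis xi_small : xi * v0%:R <= (d / 2) ^+ D * v0%:R.
(** Candidate sets have at least [(d / 2) ^+ D * v0] vertices; the left side adds up the five
    families of images excluded in [exists_image]. *)
Hypothesis room : D%:R * ((2 ^ D)%:R * (xi * v0%:R)) +
  (a + b + D * (D * b) + D * e + D * D * e)%:R < (d / 2) ^+ D * v0%:R.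

Local Notation nbh v A := (nbrs (@adj H) v A).

Definition cand A f v : {set T} :=
  [set x in V (chi v) | [forall w in nbh v A, linked gi q (f w) x]].

Lemma card_nbh v A : (#|nbh v A| <= D)%N.
Proof.
apply: leq_trans (degD v); apply: subset_leq_card.
by apply/subsetP => w; rewrite !inE => /andP[].
Qed.

(* A partial embedding of the subdivision of H: branch vertices [f v] for v in
   A and paths [P u v] for the edges inside A; W contains all vertices used so
   far, including those of rolled back branch vertices and paths. *)
Record partial A f P W : Prop := Partial {
  part_inj : {in A &, injective f};
  part_used : forall v, v \in A -> f v \in W;
  part_path : {in A &, forall u v, adj u v -> spath gi q (f u) (f v) (P u v)};
  part_rev : {in A &, forall u v, adj u v ->
     forall i, (i <= q)%N -> P v u i = P u v (q - i)%N};
  part_inner : {in A &, forall u v, adj u v -> inner q (P u v) \subset W};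
  part_avoid : {in A & &, forall u v w, adj u v -> f w \notin inner q (P u v)};
  part_disj : {in A &, forall u v, adj u v -> {in A &, forall u' v', adj u' v' ->
     [disjoint inner q (P u v) & inner q (P u' v')] \/
     (u = u' /\ v = v') \/ (u = v' /\ v = u')}};
  (* The common neighbour [w] may be any vertex of [H]: if it is still to be embedded, its image
     will have to avoid these conflicts. *)
  part_compat : {in A &, forall u v, u != v -> (exists2 w, adj u w & adj w v) ->
     (#|conflict g q (f u) (f v)| <= e)%N};
  (* Quantifying over the subsets J makes this stable under rolling back. *)
  part_cand : forall v (J : {set H}), J \subset A ->
    (d / 2) ^+ #|nbh v J| * v0%:R <= #|cand J f v|%:R }.

Lemma partial_sub A A' f P W : A' \subset A -> partial A f P W -> partial A' f P W.
Proof.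
move=> /subsetP sA [h1 h2 h3 h4 h5 h6 h7 h8 h9]; split.
- by move=> u v /sA uA /sA vA; apply: h1.
- by move=> v /sA /h2.
- by move=> u v /sA uA /sA vA; apply: h3.
- by move=> u v /sA uA /sA vA; apply: h4.
- by move=> u v /sA uA /sA vA; apply: h5.
- by move=> u v w /sA uA /sA vA /sA wA; apply: h6.
- by move=> u v /sA uA /sA vA uv u' v' /sA uA' /sA vA' uv'; apply: h7.
- by move=> u v /sA uA /sA vA; apply: h8.
- by move=> v J sJ; apply: h9; apply: subset_trans sJ _; apply/subsetP.
Qed.

(** Besides serving the present step ([B1], [B2], [B3]), the image must leave room for later ones:
    few conflicts with images of vertices that share a neighbour with [v] ([B4]), and links to many
    candidates of each neighbour of [v] ([B5]). *)
Lemma exists_image A f P W v : partial A f P W -> (#|W| <= a)%N ->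
    (forall w, w \in A -> f w \notin bad g q e W) ->
  exists x, [/\ x \in cand A f v, x \notin W, x \notin bad g q e W,
     forall w, w \in nbh v A -> x \notin hit g q (f w) W &
     [/\ {in nbh v A &, forall w w', w != w' -> x \notin conflict g q (f w) (f w')},
      forall (z w : H), adj v z -> w \in nbh z A -> (#|conflict g q (f w) x| <= e)%N &
      forall w (J : {set H}), adj v w -> J \subset nbh w A ->
        d / 2 * #|cand J f w|%:R <= #|nbrs (linked gi q) x (cand J f w)|%:R]].
Proof.
move=> pA Wa nbad; pose N := nbh v A.
have [d0 d1] := andP d01.
have d2 : 0 < d / 2 by rewrite divr_gt0.
pose F w (J : {set H}) := [set x in cand A f v |
  #|nbrs (linked gi q) x (cand J f w)|%:R < d / 2 * #|cand J f w|%:R].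
have candge w (J : {set H}) : J \subset A -> (d / 2) ^+ D * v0%:R <= #|cand J f w|%:R.
  move=> sJ; apply: le_trans (part_cand pA w sJ).
  by rewrite ler_wpM2r // ler_wiXn2l ?card_nbh //; lra.
(* A larger set would have density at least [d] to the candidates of [w], by bidensity, whereas each
   of its vertices has density below [d / 2]. *)
have Fsmall w (J : {set H}) :
    w \in nbh v setT -> J \subset nbh w A -> #|F w J|%:R <= xi * v0%:R.
  rewrite !inE /= => vw sJ'.
  have sJ : J \subset A.
    by apply: subset_trans sJ' _; apply/subsetP => u; rewrite inE => /andP[].
  rewrite leNgt; apply/negP => big.
  have sF : F w J \subset V (chi v).
    by apply/subsetP => x; rewrite !inE => /andP[/andP[]].
  have sC : cand J f w \subset V (chi w).
    by apply/subsetP => x; rewrite !inE => /andP[].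
  have [_ _ /(_ _ _ _ _ (chiP vw) sF sC (ltW big))] := bd.
  move=> /(_ (le_trans xi_small (candge w J sJ))) dense.
  have : (edges (linked gi q) (F w J) (cand J f w))%:R <=
      d / 2 * #|cand J f w|%:R * #|F w J|%:R :> R.
    by apply: edges_le_deg => x; rewrite inE => /andP[_ /ltW].
  have D0 : 0 < (d / 2) ^+ D * v0%:R.
    by apply: le_lt_trans room; rewrite !(addr_ge0, mulr_ge0).
  have c0 : 0 < #|cand J f w|%:R :> R by apply: lt_le_trans (candge w J sJ).
  have F0 : 0 < #|F w J|%:R :> R by apply: le_lt_trans big; rewrite mulr_ge0.
  by have := mulr_gt0 c0 F0; nra.
pose B1 := W :|: bad g q e W.
pose B2 := \bigcup_(w in N) hit g q (f w) W.
pose B3 := \bigcup_(w in N) \bigcup_(w' in N) 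
   (if w != w' then conflict g q (f w) (f w') else set0).
(* Badness with respect to [reach] bounds conflicts by [conflict_hit]; [card_reach] lets [card_bad]
   apply to it. *)
pose B4 := \bigcup_(z in nbh v setT) \bigcup_(w in nbh z A) bad g q e (reach g q (f w)).
(* This includes neighbours [w] already in [A], which may be rolled back and embedded anew. Only
   sets of neighbours of [w] matter, so at most [2 ^ D] sets [J] occur for each [w]. *)
pose B5 := \bigcup_(w in nbh v setT) \bigcup_(J in powerset (nbh w A)) F w J.
have /subsetPn[x xC xB] : ~~ (cand A f v \subset B1 :|: (B2 :|: (B3 :|: (B4 :|: B5)))).
  apply/negP => /subset_leq_card; rewrite leqNgt => /negP; apply.
  rewrite -(ltr_nat R); apply: lt_le_trans (candge v A (subxx A)).
  apply: le_lt_trans room.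
  have cB1 : (#|B1| <= a + b)%N.
    apply: leq_trans (leq_card_setU _ _) _; apply: leq_add => //; exact: card_bad.
  have cB2 : (#|B2| <= D * e)%N.
    apply: leq_card_bigcup; rewrite ?card_nbh // => w; rewrite inE => /andP[/nbad + _].
    by rewrite inE -leqNgt.
  have cB3 : (#|B3| <= D * (D * e))%N.
    apply: leq_card_bigcup; rewrite ?card_nbh // => w; rewrite inE => /andP[wA vw].
    apply: leq_card_bigcup; rewrite ?card_nbh // => w'; rewrite inE => /andP[wA' vw'].
    case: eqVneq => [|ww] /=; first by rewrite cards0.
    by apply: (part_compat pA) => //; exists v; rewrite // adj_sym.
  have cB4 : (#|B4| <= D * (D * b))%N.
    apply: leq_card_bigcup; rewrite ?card_nbh // => z _.
    apply: leq_card_bigcup; rewrite ?card_nbh // => w _; exact: card_bad.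
  have cB5 : #|B5|%:R <= D%:R * ((2 ^ D)%:R * (xi * v0%:R)) :> R.
    have step w : w \in nbh v setT ->
        #|\bigcup_(J in powerset (nbh w A)) F w J|%:R <= (2 ^ D)%:R * (xi * v0%:R) :> R.
      move=> vw; apply: le_trans (card_bigcup_le _) _.
        by move=> J; rewrite powersetE; apply: Fsmall vw.
      by rewrite ler_wpM2r ?mulr_ge0 // ler_nat card_powerset leq_exp2l ?card_nbh.
    apply: le_trans (card_bigcup_le step) _.
    by rewrite ler_wpM2r ?ler_nat ?card_nbh // !mulr_ge0.
  apply: le_trans (_ : (#|B1| + #|B2| + #|B3| + #|B4|)%:R + #|B5|%:R <= _).
    by rewrite -natrD ler_nat !cardsU; lia.
  rewrite [leRHS]addrC; apply: lerD => //; rewrite ler_nat; lia.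
move: xB; rewrite !inE !negb_or -!andbA => /and5P[xW xbad xB2 xB3 /andP[xB4 xB5]].
exists x; split=> //.
- by rewrite inE.
- by move=> w wN; apply: contra xB2 => ?; apply/bigcupP; exists w.
split.
- move=> w w' wN wN' ww'; apply: contra xB3 => ?; apply/bigcupP; exists w => //.
  by apply/bigcupP; exists w' => //; rewrite ww'.
- move=> z w vz wN; rewrite leqNgt; apply: contra xB4 => big.
  apply/bigcupP; exists z; first by rewrite !inE.
  apply/bigcupP; exists w => //; rewrite inE.
  by apply: leq_trans big _; apply/subset_leq_card/conflict_hit.
- move=> w J vw sJ; rewrite leNgt; apply: contra xB5 => small.
  apply/bigcupP; exists w; first by rewrite !inE.
  by apply/bigcupP; exists J; [rewrite powersetE|rewrite inE xC].
Qed.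

(** The connecting paths [Q] are arbitrary: avoiding [hit] keeps them off [W], and avoiding
    [conflict] keeps them apart from one another. Goodness is claimed for the old [W] only; vertices
    that become bad for [W'] are rolled back later. *)
Lemma partial_extend A f P W v : partial A f P W -> (#|W| <= a)%N ->
    (forall w, w \in A -> f w \notin bad g q e W) -> v \notin A ->
  exists f' P' W', [/\ partial (v |: A) f' P' W', W \subset W',
    (#|W'| <= #|W| + (D * q).+1)%N & forall w, w \in v |: A -> f' w \notin bad g q e W].
Proof.
move=> pA Wa nbad vA.
have [x [xC xW xbad xhit [xconf xcompat xcand]]] := exists_image v pA Wa nbad.
have [Q QP] : exists Q : H -> nat -> T,
    forall w, w \in nbh v A -> spath gi q (f w) x (Q w).
  suff ex w : exists Qw, w \in nbh v A -> spath gi q (f w) x Qw.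
    by have [Q QP] := boolp.choice ex; exists Q.
  case: (boolP (w \in nbh v A)) => [wN|_]; last by exists (fun=> x).
  move: xC; rewrite inE => /andP[_ /forall_inP/(_ w wN)/asboolP[w' ww']].
  by exists w'.
pose f' w := if w == v then x else f w.
pose P' u1 u2 := if u2 == v then Q u1 else
  if u1 == v then fun i => Q u2 (q - i)%N else P u1 u2.
pose W' := W :|: (x |: \bigcup_(w in nbh v A) inner q (Q w)).
have sW : W \subset W' by apply: subsetUl.
have neqv w : w \in A -> (w == v) = false.
  by move=> wA; apply/negbTE; apply: contraNneq vA => <-.
have f'v : f' v = x by rewrite /f' eqxx.
have f'A w : w \in A -> f' w = f w by move=> /neqv; rewrite /f' => ->.
have nbhA w : w \in nbh v A -> w \in A by rewrite inE => /andP[].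
have QW w : w \in nbh v A -> [disjoint inner q (Q w) & W].
  move=> wN; apply: contraNT (xhit w wN) => dQ; rewrite inE; apply/asboolP.
  by exists (Q w) => //; apply: walk_sub gig _; case: (QP w wN).
have QQ w w' : w \in nbh v A -> w' \in nbh v A -> w != w' ->
    [disjoint inner q (Q w) & inner q (Q w')].
  move=> wN wN' ww'; apply: contraNT (xconf w w' wN wN' ww') => dQ.
  rewrite inE; apply/asboolP; exists (Q w), (Q w').
  by split=> //; apply: walk_sub gig _; [case: (QP w wN)|case: (QP w' wN')].
have Qx w : w \in nbh v A -> x \notin inner q (Q w).
  move=> wN; apply/negP => /innerP[i /andP[_ iq] xi'].
  have [[_ Qq _] /(_ i q (ltnW iq) (leqnn q))] := QP w wN.
  by rewrite Qq -xi' => /(_ erefl) iq'; rewrite iq' ltnn in iq.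
have QsW w : w \in nbh v A -> inner q (Q w) \subset W'.
  move=> wN; apply/subsetP => y yQ; rewrite !inE; apply/or3P; apply: Or33.
  by apply/bigcupP; exists w.
have cls u1 u2 : u1 \in v |: A -> u2 \in v |: A -> adj u1 u2 ->
    [\/ [/\ u1 \in A, u2 \in A, P' u1 u2 = P u1 u2 & P' u2 u1 = P u2 u1],
        [/\ u1 \in nbh v A, u2 = v, P' u1 u2 = Q u1 &
            P' u2 u1 = fun i => Q u1 (q - i)%N] |
        [/\ u2 \in nbh v A, u1 = v, P' u2 u1 = Q u2 &
            P' u1 u2 = fun i => Q u2 (q - i)%N]].
  rewrite !in_setU1 => /predU1P[->|uA1] /predU1P[->|uA2] u12.
  - by rewrite adj_irr in u12.
  - by apply: Or33; rewrite /P' eqxx neqv // inE uA2.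
  - by apply: Or32; rewrite /P' eqxx neqv // inE uA1 adj_sym.
  - by apply: Or31; rewrite /P' !neqv.
have cls' u1 u2 : u1 \in v |: A -> u2 \in v |: A -> adj u1 u2 ->
    [/\ u1 \in A, u2 \in A & P' u1 u2 = P u1 u2] \/
    exists w, [/\ w \in nbh v A, (u1 = w /\ u2 = v) \/ (u1 = v /\ u2 = w) &
      inner q (P' u1 u2) = inner q (Q w)].
  move=> uA1 uA2 /(cls _ _ uA1 uA2)[[-> -> ->]|[uN -> -> _]|[uN -> _ ->]];
    [by left|right|right].
    by exists u1; split=> //; left.
  by exists u2; split=> //; [right|rewrite inner_rev].
exists f', P', W'; split=> //; last first.
- by move=> w; rewrite in_setU1 => /predU1P[->|wA]; rewrite ?f'v ?f'A //; exact: nbad.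
- rewrite /W' !cardsU cards1.
  have : (#|\bigcup_(w in nbh v A) inner q (Q w)| <= D * q)%N.
    by apply: leq_card_bigcup; rewrite ?card_nbh // => w _; apply: card_inner.
  by clear; lia.
(* Adding [v] changes the candidates of [w] only if they are adjacent; then they are cut down to the
   vertices linked to [x], at the cost of one factor [d / 2]. *)
have candJ (J : {set H}) w : J \subset v |: A -> cand J f' w =
    cand (J :\ v) f w :&: [set y | (v \in nbh w J) ==> linked gi q x y].
  move=> sJ; apply/setP => y; rewrite !inE -andbA; congr (_ && _).
  apply/forall_inP/andP => [hy|[/forall_inP hy /implyP hv] z].
    split; last first.
      by apply/implyP => vJ; have := hy v; rewrite f'v inE => /(_ vJ).
    apply/forall_inP => z; rewrite !inE => /andP[/andP[zv zJ] wz].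
    have := hy z; rewrite inE zJ wz f'A; first exact.
    by move: (subsetP sJ z zJ); rewrite in_setU1 (negbTE zv).
  rewrite inE => /andP[zJ wz]; have [zv|zv] := eqVneq z v.
    by rewrite zv f'v; apply: hv; rewrite -zv zJ.
  rewrite f'A; last by move: (subsetP sJ z zJ); rewrite in_setU1 (negbTE zv).
  by apply: hy; rewrite !inE zv zJ.
split.
- move=> u1 u2; rewrite !in_setU1 => /predU1P[->|uA1] /predU1P[->|uA2] //.
  + by rewrite f'v f'A // => xu; rewrite xu (part_used pA) in xW.
  + by rewrite f'v f'A // => xu; rewrite -xu (part_used pA) in xW.
  + by rewrite !f'A //; apply: (part_inj pA).
- move=> w; rewrite in_setU1 => /predU1P[->|wA]; first by rewrite f'v !inE eqxx orbT.
  by rewrite f'A //; apply/(subsetP sW)/(part_used pA).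
- move=> u1 u2 uA1 uA2 u12.
  have [[uA1' uA2' -> _]|[uN -> -> _]|[uN -> _ ->]] := cls _ _ uA1 uA2 u12.
  + by rewrite !f'A //; apply: (part_path pA).
  + by rewrite f'v f'A ?nbhA //; apply: QP.
  + by rewrite f'v f'A ?nbhA //; apply: spath_rev => //; apply: QP.
- move=> u1 u2 uA1 uA2 u12 i iq.
  have [[uA1' uA2' -> ->]|[uN -> -> ->]|[uN -> -> ->]] := cls _ _ uA1 uA2 u12 => //.
  + exact: (part_rev pA).
  + by rewrite subKn.
- move=> u1 u2 uA1 uA2 u12.
  have [[uA1' uA2' ->]|[w [wN _ ->]]] := cls' _ _ uA1 uA2 u12; last exact: QsW.
  by apply: subset_trans sW; apply: (part_inner pA).
- move=> u1 u2 w uA1 uA2 wA u12.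
  have [[uA1' uA2' ->]|[w' [wN _ ->]]] := cls' _ _ uA1 uA2 u12.
  + move: wA; rewrite in_setU1 => /predU1P[->|wA]; rewrite ?f'v ?f'A //.
      by apply: contra xW => /(subsetP (part_inner pA uA1' uA2' u12)).
    exact: (part_avoid pA).
  + move: wA; rewrite in_setU1 => /predU1P[->|wA]; rewrite ?f'v ?f'A //.
      exact: Qx.
    by apply/negP => /(disjointFr (QW _ wN)); rewrite (part_used pA).
- move=> u1 u2 uA1 uA2 u12 u3 u4 uA3 uA4 u34.
  have [[uA1' uA2' ->]|[w [wN w12 ->]]] := cls' _ _ uA1 uA2 u12;
  have [[uA3' uA4' ->]|[w' [wN' w34 ->]]] := cls' _ _ uA3 uA4 u34.
  + exact: (part_disj pA).
  + left; rewrite disjoint_sym; apply: disjointWr (QW _ wN').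
    exact: (part_inner pA).
  + left; apply: disjointWr (QW _ wN); exact: (part_inner pA).
  + have [ww'|ww'] := eqVneq w w'; last by left; apply: QQ.
    right; rewrite -{}ww' in w34 => {w' wN'}.
    by move: w12 w34 => [[-> ->]|[-> ->]] [[-> ->]|[-> ->]]; [left|right|right|left].
- move=> u1 u2; rewrite !in_setU1 => /predU1P[->|uA1] /predU1P[->|uA2] //.
  + by rewrite eqxx.
  + move=> _ [w vw wu]; rewrite f'v f'A // conflictC.
    by apply: (xcompat w) => //; rewrite inE uA2.
  + move=> _ [w uw wv]; rewrite f'v f'A //.
    by apply: (xcompat w); rewrite 1?adj_sym // inE uA1 adj_sym.
  + by rewrite !f'A //; apply: (part_compat pA).
- move=> w J sJ; rewrite candJ //.
  have sJA : J :\ v \subset A by rewrite subDset.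
  have [vN|vN] := boolP (v \in nbh w J); last first.
    have -> : nbh w J = nbh w (J :\ v).
      apply/setP => z; rewrite !inE; case: eqVneq => // ->.
      by move: vN; rewrite inE => /negbTE ->.
    apply: le_trans (part_cand pA w sJA) _; rewrite ler_nat subset_leq_card //.
    by apply/subsetP => y yC; rewrite inE yC inE.
  have vw : adj v w by move: vN; rewrite inE adj_sym => /andP[].
  have -> : #|nbh w J| = #|nbh w (J :\ v)|.+1.
    rewrite (cardsD1 v) vN add1n; congr _.+1; apply: eq_card => z.
    by rewrite !inE andbA.
  have candN : cand (J :\ v) f w = cand (nbh w (J :\ v)) f w.
    apply/setP => y; rewrite !inE; congr (_ && _).
    by apply: eq_forallb => z; rewrite !inE -!andbA andbb.
  have sN : nbh w (J :\ v) \subset nbh w A.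
    by apply/subsetP => z; rewrite !inE => /andP[zJ ->]; rewrite andbT (subsetP sJA) // !inE.
  rewrite exprS -mulrA; apply: le_trans (_ : d / 2 * #|cand (J :\ v) f w|%:R <= _).
    rewrite ler_wpM2l ?divr_ge0 //; first by case/andP: d01 => /ltW.
    exact: (part_cand pA).
  rewrite candN; apply: le_trans (xcand w _ vw sN) _.
  by rewrite ler_nat -candN subset_leq_card //; apply/subsetP => y; rewrite !inE.
Qed.

(* Each step either enlarges A or makes a vertex bad forever, so
   [#|A| + #|bad W|] grows until the embedding is complete. *)
Lemma partial_complete : (0 < #|T|)%N -> ((D * q).+1 * (#|H| + b).+1 <= a)%N ->
  exists f P W, partial setT f P W.
Proof.
move=> T0 Ta; apply: contrapT => noemb.
suff main : forall t, (t <= (#|H| + b).+1)%N -> exists A f P W,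
    [/\ partial A f P W, forall w, w \in A -> f w \notin bad g q e W,
        (#|W| <= (D * q).+1 * t)%N & (t <= #|A| + #|bad g q e W|)%N].
  have [A [f [P [W [_ _ Wt]]]]] := main _ (leqnn _).
  have := card_bad (leq_trans Wt Ta); have : (#|A| <= #|H|)%N by apply: max_card.
  lia.
elim=> [_|t IHt tb].
  have [x0 _] : exists x0 : T, x0 \in T by apply/card_gt0P.
  have p0 : partial set0 (fun=> x0) (fun _ _ _ => x0) set0.
    split; try by move=> ?; rewrite inE.
    move=> v J; rewrite subset0 => /eqP ->.
    have -> : nbh v set0 = set0 by apply/setP => w; rewrite !inE.
    rewrite cards0 expr0 mul1r ler_nat; have [cV _ _] := bd.
    rewrite -(cV (chi v)); apply/subset_leq_card/subsetP => x; rewrite !inE => ->.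
    by apply/forall_inP => w; rewrite !inE.
  exists set0, (fun=> x0), (fun _ _ _ => x0), set0.
  by split=> // [w|]; rewrite ?inE ?cards0.
have [A [f [P [W [pA nbad Wt tA]]]]] := IHt (ltnW tb).
have Wa : (#|W| <= a)%N by apply: leq_trans Wt (leq_trans _ Ta); rewrite leq_mul2l ltnW ?orbT.
have /subsetPn[v _ vA] : ~~ ([set: H] \subset A).
  apply/negP; rewrite subTset => /eqP eA; apply: noemb.
  by exists f, P, W; rewrite -eA.
have [f' [P' [W' [pA' sW cW nbad']]]] := partial_extend pA Wa nbad vA.
pose A' := [set w in v |: A | f' w \notin bad g q e W'].
have sA' : A' \subset v |: A by apply/subsetP => w; rewrite inE => /andP[].
exists A', f', P', W'; split.
- exact: partial_sub pA'.
- by move=> w; rewrite inE => /andP[].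
- by apply: leq_trans cW _; rewrite mulnS addnC leq_add2l.
(* A rolled back vertex has an image that is bad for [W'] but not for [W], and [f'] is injective:
   what [A] loses, the bad set gains. *)
have cR : (#|(v |: A) :\: A'| <= #|bad g q e W' :\: bad g q e W|)%N.
  rewrite -(card_in_imset (f := f')); last first.
    move=> u1 u2 /setDP[u1A _] /setDP[u2A _]; exact: (part_inj pA').
  apply/subset_leq_card/subsetP => y /imsetP[w /setDP[wA wA'] ->].
  rewrite inE nbad' //=; move: wA'; rewrite inE wA /=.
  by rewrite negbK.
have := cardsU1 v A; rewrite vA => cvA.
have := subset_leq_card (badS g q e sW); have := subset_leq_card sA'.
move: cR; rewrite !cardsD (setIidPr sA') (setIidPr (badS g q e sW)) cvA.
by move: tA; clear; lia.
Qed.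

End Embedding.

(** * From a complete partial embedding to a copy of the subdivision *)

Section ToSubdivision.
Variables (R : realType) (T : finType) (g gi : rel T) (q : nat).
Variables (H : sgraph) (k : nat) (chi : H -> 'I_k) (V : 'I_k -> {set T}).
Variables (d : R) (v0 e : nat) (f : H -> T) (P : H -> H -> nat -> T) (W : {set T}).
Hypothesis q0 : (0 < q)%N.
Hypothesis giC : symmetric gi.
Hypothesis pT : partial g gi q chi V d v0 e setT f P W.

Definition subdivision_map (x : subdiv_vertex H q) : T :=
  match x with
  | inl v => f v
  | inr (oe, j) => P (val oe).1 (val oe).2 j.+1
  end.

Lemma oriented_edge_adj (oe : oriented_edge H) : adj (val oe).1 (val oe).2.
Proof. by case/andP: (valP oe). Qed.

Lemma spath_edge (oe : oriented_edge H) :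
  spath gi q (f (val oe).1) (f (val oe).2) (P (val oe).1 (val oe).2).
Proof. by apply: (part_path pT); rewrite ?inE // oriented_edge_adj. Qed.

Lemma subdivision_map_path (oe : oriented_edge H) (j : nat) : (j <= q)%N ->
  subdivision_map (subdiv_path q oe j) = P (val oe).1 (val oe).2 j.
Proof.
have [[P0 Pq _] _] := spath_edge oe.
case: j => [|j] jq; first by rewrite /= P0.
rewrite /=; case: insubP => [i _ <- //|]; rewrite -leqNgt => qj /=.
by rewrite -Pq; congr P; lia.
Qed.

Lemma inner_edge (oe : oriented_edge H) (j : 'I_q.-1) :
  P (val oe).1 (val oe).2 j.+1 \in inner q (P (val oe).1 (val oe).2).
Proof. apply/innerP; exists j.+1 => //; have := ltn_ord j; lia. Qed.

Lemma subdivision_map_inj : injective subdivision_map.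
Proof.
have avoid v (oe : oriented_edge H) (j : 'I_q.-1) :
    f v <> P (val oe).1 (val oe).2 j.+1.
  move=> fv; have := inner_edge oe j; rewrite -fv; apply/negP.
  by apply: (part_avoid pT); rewrite ?inE // oriented_edge_adj.
move=> [v|[oe j]] [v'|[oe' j']] //=.
- by move=> /(part_inj pT) -> //; rewrite inE.
- by move/avoid.
- by move/esym/avoid.
move=> eP; suff eoe : oe = oe'.
  subst oe'; have [_ PI] := spath_edge oe.
  suff -> : j = j' by [].
  apply/val_inj/succn_inj; apply: PI eP; [have := ltn_ord j|have := ltn_ord j']; lia.
have [dj|[[e1 e2]|[e1 e2]]] := part_disj pT (in_setT _) (in_setT _)
  (oriented_edge_adj oe) (in_setT _) (in_setT _) (oriented_edge_adj oe').
- have := disjointFr dj (inner_edge oe j).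
  by rewrite eP inner_edge.
- by apply: val_inj; rewrite [LHS]surjective_pairing [RHS]surjective_pairing e1 e2.
(* The same edge traversed backwards is impossible, since both orientations follow the enumeration
   of the vertices. *)
- have /andP[_] := valP oe; have /andP[_] := valP oe'; rewrite e1 e2.
  by move=> /ltn_trans lt /lt; rewrite ltnn.
Qed.

Lemma subdivision_map_adj x y : subdiv_adj x y ->
  gi (subdivision_map x) (subdivision_map y).
Proof.
move=> /existsP[oe /existsP[i]]; have [[_ _ Pg] _] := spath_edge oe.
have iq := ltn_ord i.
by move=> /orP[]/andP[/eqP-> /eqP->]; [|rewrite giC];
  rewrite !subdivision_map_path ?Pg // ltnW.
Qed.

End ToSubdivision.

(** * Few vertices are bad *)

Section FewBad.
Variables (T : finType) (g : rel T) (Delta kappa b y0 : nat).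
Implicit Types (u x : T) (W Y : {set T}) (l : nat).
Hypothesis Delta0 : (0 < Delta)%N.
Hypothesis degD : forall x, (#|nbrs g x setT| <= Delta)%N.
Hypothesis few_rich : forall Y, (#|Y| <= y0)%N ->
  (#|[set v | (kappa < #|nbrs g v Y|)%N]| <= b)%N.

Definition sphere l u : {set T} := [set x | `[< exists w, walk g l u x w >]].

(** Unlike in [hit], the start of the walk counts: after the first step of a walk, an inner vertex
    becomes the start of a shorter one. *)
Definition early_hit l u W : {set T} :=
  [set x | `[< exists w i, [/\ walk g l u x w, (i < l)%N & w i \in W] >]].

(** A vertex outside [rich W l] is outside [W] and sends at most [kappa] edges into each lower
    level, so few ends of its walks of length [l] are reached through [W]. By [few_rich] each level
    adds at most [b] vertices. *)
Fixpoint rich W l : {set T} :=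
  if l is l'.+1 then
    rich W l' :|: [set v | (kappa < #|nbrs g v (rich W l')|)%N]
  else W.

Lemma walk_tail l u x w : walk g l.+1 u x w ->
  w 1%N \in nbrs g u setT /\ walk g l (w 1%N) x (fun i => w i.+1).
Proof.
move=> [w0 wl wg]; split; first by rewrite inE inE -w0 wg.
by split=> // i il; apply: wg.
Qed.

Lemma card_sphere l u : (#|sphere l u| <= Delta ^ l)%N.
Proof.
elim: l u => [|l IHl] u.
  rewrite expn0 -(cards1 u); apply/subset_leq_card/subsetP => x.
  by rewrite !inE => /asboolP[w [<- <- _]].
apply: leq_trans (_ : #|\bigcup_(v in nbrs g u setT) sphere l v| <= _)%N.
  apply/subset_leq_card/subsetP => x; rewrite inE => /asboolP[w /walk_tail[uw ww]].
  by apply/bigcupP; exists (w 1%N); rewrite // inE; apply/asboolP; exists (fun i => w i.+1).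
by rewrite expnS; apply: leq_card_bigcup.
Qed.

Lemma card_rich W l : (#|W| + l * b <= y0)%N -> (#|rich W l| <= #|W| + l * b)%N.
Proof.
elim: l => [|l IHl] Wl; first by rewrite addn0.
have Wl' : (#|W| + l * b <= y0)%N.
  by apply: leq_trans Wl; rewrite leq_add2l leq_mul2r leqnSn orbT.
apply: leq_trans (leq_card_setU _ _) _; rewrite mulSn addnCA addnC.
by apply: leq_add; [apply/few_rich/(leq_trans (IHl Wl'))|apply: IHl].
Qed.

Lemma sub_rich W l : W \subset rich W l.
Proof. by elim: l => //= l /subset_trans; apply; apply: subsetUl. Qed.

(** Split by the first step: at most [kappa] neighbours are rich, with at most [Delta ^ l] ends
    each; the at most [Delta] others fall under the inductive bound. This is separate from the
    induction because [card_bad_le] uses it for a start that may lie in [W]. *)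
Lemma early_hit_step W l u :
  (forall v, v \notin rich W l -> #|early_hit l v W| <= l * (kappa * Delta ^ l.-1))%N ->
  (#|nbrs g u (rich W l)| <= kappa)%N ->
  (#|\bigcup_(v in nbrs g u setT) early_hit l v W| <= l.+1 * (kappa * Delta ^ l))%N.
Proof.
move=> IHl uk; pose N1 := nbrs g u (rich W l); pose N2 := nbrs g u (~: rich W l).
have sub : \bigcup_(v in nbrs g u setT) early_hit l v W \subset
    \bigcup_(v in N1) early_hit l v W :|: \bigcup_(v in N2) early_hit l v W.
  apply/subsetP => x /bigcupP[v]; rewrite inE => /andP[_ uv] xv.
  by rewrite inE; case: (boolP (v \in rich W l)) => vr; apply/orP; [left|right];
    apply/bigcupP; exists v => //; rewrite !inE ?vr.
apply: leq_trans (subset_leq_card sub) _; apply: leq_trans (leq_card_setU _ _) _.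
rewrite mulSn; apply: leq_add.
  apply: leq_card_bigcup => // v _; apply: leq_trans (card_sphere l v).
  apply/subset_leq_card/subsetP => x; rewrite !inE => /asboolP[w [i [ww _ _]]].
  by apply/asboolP; exists w.
(* For length 0 the exponent [l.-1] does not drop, but there are no early hits. *)
case: l => [|l] in IHl uk N1 N2 sub *.
  rewrite mul0n big1 ?cards0 // => v _; apply/setP => x; rewrite !inE.
  by apply/negbTE/negP => /asboolP[w [i []]].
apply: leq_trans (_ : Delta * (l.+1 * (kappa * Delta ^ l)) <= _)%N; last first.
  by rewrite mulnCA leq_mul2l mulnCA -expnS leqnn orbT.
apply: leq_card_bigcup => [|v]; last by rewrite inE => /andP[+ _]; rewrite in_setC => /IHl.
apply: leq_trans (degD u); apply/subset_leq_card/subsetP => v.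
by rewrite !inE => /andP[_ ->].
Qed.

Lemma card_early_hit W l u : u \notin rich W l ->
  (#|early_hit l u W| <= l * (kappa * Delta ^ l.-1))%N.
Proof.
elim: l u => [|l IHl] u /=.
  move=> _; rewrite mul0n leqn0 cards_eq0; apply/eqP/setP => x; rewrite !inE.
  by apply/negbTE/negP => /asboolP[w [i []]].
rewrite inE negb_or inE -leqNgt => /andP[ul uk].
apply: leq_trans (early_hit_step IHl uk); apply/subset_leq_card/subsetP => x.
rewrite inE => /asboolP[w [[|i] [ww il iW]]].
  by case: ww => w0 _ _; rewrite w0 in iW; rewrite (subsetP (sub_rich W l)) in ul.
have [uw ww'] := walk_tail ww; apply/bigcupP; exists (w 1%N) => //.
by rewrite inE; apply/asboolP; exists (fun i => w i.+1), i.
Qed.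

(** The start of a walk is not an inner vertex, so a bad vertex only needs many neighbours in
    [rich W q.-1]. One application of [few_rich] then gives [b], however large [W] is within the
    limit. *)
Lemma card_bad_le q W : (0 < q)%N -> (#|W| + q * b <= y0)%N ->
  (#|bad g q (q * (kappa * Delta ^ q.-1)) W| <= b)%N.
Proof.
case: q => // q _ Wy.
have Wq : (#|W| + q * b <= y0)%N.
  by apply: leq_trans Wy; rewrite leq_add2l leq_mul2r leqnSn orbT.
apply: leq_trans (few_rich (leq_trans (card_rich Wq) Wq)).
apply/subset_leq_card/subsetP => u; rewrite !inE; apply: contraTT.
rewrite -!leqNgt => uk; apply: leq_trans (early_hit_step (@card_early_hit W q) uk).
apply/subset_leq_card/subsetP => x; rewrite inE => /asboolP[w ww].
move=> /pred0Pn[y /andP[/innerP[[|i] // /andP[_ iq] ->] iW]].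
have [uw ww'] := walk_tail ww; apply/bigcupP; exists (w 1%N) => //.
by rewrite inE; apply/asboolP; exists (fun i => w i.+1), i.
Qed.

Lemma card_reach_le q u : (#|reach g q u| <= q * Delta ^ q.-1)%N.
Proof.
apply: leq_trans (_ : #|\bigcup_(l in [set: 'I_q]) sphere l u| <= _)%N.
  apply/subset_leq_card/subsetP => x; rewrite inE => /asboolP[l [w [/andP[l0 lq] ww]]].
  by apply/bigcupP; exists (Ordinal lq); rewrite ?inE //; apply/asboolP; exists w.
apply: leq_card_bigcup => [|l _]; first by rewrite cardsT card_ord.
apply: leq_trans (card_sphere _ _) _; apply: leq_pexp2l => //.
have := ltn_ord l; lia.
Qed.

End FewBad.

(** * Pseudorandom graphs are Ramsey *)

(** Excludes the sparse alternative of [bidense_or_sparse_all] for linked pairs, with [delta] the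
    constant [(8192 * r) ^- 2]. *)
Lemma pseudorandom_paths_dense (R : realType) (G : sgraph) (gi : nat -> rel G)
    (q r m : nat) (p w : R) (S : {set G}) :
  (forall i, symmetric (gi i)) -> (forall i, subrel (gi i) (@adj G)) ->
  (forall x y : G, adj x y -> exists2 i, (i < r)%N & gi i x y) ->
  (2 <= q)%N -> (0 < r)%N -> (2 <= m)%N -> 0 < p -> w <= #|S|%:R ->
  p * #|S|%:R ^+ 2 / 8 <= (edges (@adj G) S S)%:R ->
  (forall j (X Y : {set G}), (j < q.-1)%N -> #|X| = (m ^ j)%N ->
     (#|Y| <= 2 * m ^ j.+1)%N ->
     (edges (@adj G) X Y)%:R < 16 * q%:R * m%:R * #|X|%:R :> R) ->
  (forall X Y : {set G}, #|X| = (m ^ q.-1)%N ->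
     (edges (@adj G) X Y)%:R <=
       12 * p * #|X|%:R * (#|Y|%:R + w / (3072 * r%:R))) ->
  1024 * q%:R * r%:R * m%:R <= p * w ->
  4096 * r%:R * m%:R ^+ q.-1 <= w -> 4096 * r%:R <= w ->
  exists2 i, (i < r)%N &
    (8192 * r%:R) ^- 2 * #|S|%:R ^+ 2 < (edges (linked (gi i) q) S S)%:R :> R.
Proof.
move=> giC gig gcol q2 r0 m2 p0 wS low small large hm hmq hw.
have r0' : 0 < r%:R :> R by rewrite ltr0n.
set s : R := #|S|%:R; pose y := s / (2048 * r%:R); pose z := Num.truncn y.
have ey : y * (2048 * r%:R) = s by rewrite /y divfK ?gt_eqF ?mulr_gt0 ?ltr0n.
have y2 : 2 <= y.
  have r2 : 0 < 2048 * r%:R :> R by rewrite mulr_gt0 ?ltr0n.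
  by rewrite -(ler_pM2r r2) ey; move: wS hw; rewrite -/s; clear; lra.
have y0 : 0 <= y by apply: le_trans y2.
have /andP[zy yz] : z%:R <= y < z.+1%:R by exact: truncn_itv.
have s0 : 0 < s by apply: lt_le_trans wS; apply: lt_le_trans hw; rewrite mulr_gt0 ?ltr0n.
(* Then [4 * r * mu * #|S|] is [p * #|S|^2 / 16], half of the edges guaranteed by [low], and
   [mu = 32 * p * y]. *)
pose mu : R := p * s / (64 * r%:R).
have emu : mu * (64 * r%:R) = p * s by rewrite /mu divfK ?gt_eqF ?mulr_gt0 ?ltr0n.
have mu0 : 0 < mu by rewrite divr_gt0 ?mulr_gt0.
have m0 : 0 < m%:R :> R by rewrite ltr0n; apply: leq_trans m2.
have [|||i ir zz] := @mono_paths_dense R G (@adj G) gi r q m z S mu giC gig gcol q2 m2 mu0.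
- have -> : 4 * r%:R * mu * #|S|%:R = (mu * (64 * r%:R)) * s / 16 by rewrite /s; field.
  rewrite emu; apply: lt_le_trans low; rewrite -/s.
  have : 0 < p * s * s by rewrite !mulr_gt0.
  by rewrite expr2; clear; lra.
- move=> j X Y jq cX cY; apply: lt_le_trans (small j X Y jq cX cY) _.
  rewrite ler_wpM2r //.
  have r3 : 0 < 64 * r%:R :> R by rewrite mulr_gt0 ?ltr0n.
  rewrite -(ler_pM2r r3) emu.
  apply: le_trans (_ : p * w <= _); last by rewrite ler_wpM2l // ltW.
  by apply: le_trans hm; rewrite le_eqVlt; apply/orP; left; apply/eqP; ring.
- move=> X Y cX /le_trans /(_ (large X Y cX)).
  have X0 : 0 < #|X|%:R :> R by rewrite cX natrX exprn_gt0.
  rewrite [leRHS](_ : _ = 12 * p * (#|Y|%:R + w / (3072 * r%:R)) * #|X|%:R); last by ring.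
  rewrite ler_pM2r // => muY.
  (* From [mu = 32 * p * y] follows [#|Y| + w' >= 8/3 * y], and the slack [w'] is at most
     [2/3 * y]. *)
  have yY : 2 * y <= #|Y|%:R.
    pose w' := w / (3072 * r%:R).
    have ew : w' * (3072 * r%:R) = w by rewrite /w' divfK ?gt_eqF ?mulr_gt0 ?ltr0n.
    have w'y : 3 * w' <= 2 * y.
      have r2 : 0 < 1024 * r%:R :> R by rewrite mulr_gt0 ?ltr0n.
      by rewrite -(ler_pM2r r2); move: ew ey wS; rewrite -/s; clear; lra.
    have : p * (8 / 3 * y) <= p * (#|Y|%:R + w').
      rewrite -(ler_pM2l (_ : 0 < 12)) //.
      have -> : 12 * (p * (#|Y|%:R + w')) = 12 * p * (#|Y|%:R + w') by rewrite mulrA.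
      apply: le_trans muY; rewrite -(ler_pM2r (_ : 0 < 64 * r%:R :> R)) ?mulr_gt0 //.
      by rewrite emu -ey le_eqVlt; apply/orP; left; apply/eqP; field.
    by rewrite ler_pM2l //; move: w'y; clear; lra.
  have my : 2 * m%:R ^+ q.-1 <= y.
    have r2 : 0 < 2048 * r%:R :> R by rewrite mulr_gt0 ?ltr0n.
    by rewrite -(ler_pM2r r2) ey; move: wS hmq; rewrite -/s; clear; lra.
  rewrite -(ler_nat R) natrD natrM natrX.
  by move: zy yY my; clear; lra.
exists i => //; rewrite -/s; apply: lt_le_trans (_ : (z * z)%:R <= _); last first.
  by rewrite ler_nat.
have -> : (8192 * r%:R) ^- 2 * s ^+ 2 = (y / 4) ^+ 2.
  by rewrite /y; field; rewrite gt_eqF.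
rewrite natrM expr2; have yz' : y / 2 <= z%:R by move: yz y2; rewrite -natr1; clear; lra.
have y4 : 0 <= y / 4 by rewrite divr_ge0.
have y4z : y / 4 < z%:R by move: yz' y2; clear; lra.
exact: ltr_pM.
Qed.

(** The regularity scale at which the atypical vertices, summed over [D] neighbours and [2 ^ D]
    subsets, use up a quarter of the guaranteed candidates. *)
Definition spread (R : realType) (D : nat) (d : R) : R :=
  (d / 2) ^+ D / (4 * (D%:R * (2 ^ D)%:R)).

Lemma spreadE (R : realType) (D : nat) (d : R) : (0 < D)%N ->
  D%:R * ((2 ^ D)%:R * spread D d) = (d / 2) ^+ D / 4.
Proof.
move=> D0; rewrite /spread; field.
by rewrite !pnatr_eq0 -!lt0n expn_gt0 D0.
Qed.

Lemma spread_gt0 (R : realType) (D : nat) (d : R) :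
  (0 < D)%N -> 0 < d -> 0 < spread D d.
Proof.
move=> D0 d0; rewrite divr_gt0 ?exprn_gt0 ?divr_gt0 //.
by rewrite !mulr_gt0 ?ltr0n ?expn_gt0.
Qed.

(** Isolates what is asked of the random graph. [M] and [d0] come before the graph and its
    parameters, so these may be tuned to them. *)
Lemma pseudorandom_ramsey (R : realType) (D q r : nat) :
  (2 <= q)%N -> (0 < D)%N -> (0 < r)%N ->
  exists (M : nat) (d0 : R), [/\ (0 < M)%N, 0 < d0 &
  forall (G : sgraph) (p : R) (m w a b e N : nat),
  (M * w <= #|G|)%N -> 0 < p -> (2 <= m)%N ->
  (forall S : {set G}, (w <= #|S|)%N ->
     p * #|S|%:R ^+ 2 / 8 <= (edges (@adj G) S S)%:R) ->
  (forall j (X Y : {set G}), (j < q.-1)%N -> #|X| = (m ^ j)%N ->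
     (#|Y| <= 2 * m ^ j.+1)%N ->
     (edges (@adj G) X Y)%:R < 16 * q%:R * m%:R * #|X|%:R :> R) ->
  (forall X Y : {set G}, #|X| = (m ^ q.-1)%N ->
     (edges (@adj G) X Y)%:R <=
       12 * p * #|X|%:R * (#|Y|%:R + w%:R / (3072 * r%:R))) ->
  1024 * q%:R * r%:R * m%:R <= p * w%:R ->
  4096 * r%:R * m%:R ^+ q.-1 <= w%:R :> R -> 4096 * r%:R <= w%:R :> R ->
  (forall W : {set G}, (#|W| <= a)%N -> (#|bad (@adj G) q e W| <= b)%N) ->
  (forall x : G, (#|reach (@adj G) q x| <= a)%N) ->
  ((D * q).+1 * (N + b).+1 <= a)%N ->
  (a + b + D * (D * b) + D * e + D * D * e)%:R < (d0 / 2) ^+ D / 2 * w%:R ->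
  forall H : sgraph, (#|H| <= N)%N -> (forall v : H, degree v <= D)%N ->
  ramsey G (subdivision H q) r].
Proof.
move=> q2 D0 r0.
have delta0 : 0 < (8192 * r%:R) ^- 2 :> R.
  by rewrite invr_gt0 exprn_gt0 ?mulr_gt0 ?ltr0n.
have spread0 (d : R) := @spread_gt0 R D d D0.
have [M [d0 [M0 d00 dich]]] := bidense_or_sparse_all D.+1 r delta0 spread0.
clear delta0.
exists M, d0; split=> // G p m w a b e N MG p0 m2 low small large hm hmq hw.
move=> few_bad few_reach Na room H HN degH col.
pose gi i : rel G := fun x y => adj x y && (val (col [set x; y]) == i).
have giC i : symmetric (gi i) by move=> x y; rewrite /gi adj_sym setUC.
have gig i : subrel (gi i) (@adj G) by move=> x y /andP[].
have gcol (x y : G) : adj x y -> exists2 i, (i < r)%N & gi i x y.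
  by move=> xy; exists (val (col [set x; y])); rewrite ?ltn_ord // /gi xy eqxx.
have w0 : (0 < w)%N.
  by rewrite -(ltr_nat R); apply: lt_le_trans hw; rewrite mulr_gt0 ?ltr0n.
have linkC i : symmetric (linked (gi i) q) by apply: linked_sym.
have MGT : (M * w <= #|[set: G]|)%N by rewrite cardsT.
have [[i [d [v [V [ir /andP[d0d d1] wv bd]]]]]|[S _ [wS sparse]]] :=
    dich G (fun i => linked (gi i) q) setT w linkC MGT; last first.
  have wS' : w%:R <= #|S|%:R :> R by rewrite ler_nat.
  have [i ir] := pseudorandom_paths_dense giC gig gcol q2 r0 m2 p0 wS'
    (low S wS) small large hm hmq hw.
  by rewrite ltNge sparse.
have d_gt0 : 0 < d by apply: lt_le_trans d0d.
have [chi chiP] := greedy_coloring degH.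
have v0 : 0 < v%:R :> R by rewrite ltr0n; apply: leq_trans wv.
have dD0 : 0 < (d / 2) ^+ D by rewrite exprn_gt0 // divr_gt0.
have q0 : (0 < q)%N by apply: leq_trans q2.
have d01 : 0 < d <= 1 by rewrite d_gt0.
have xi_small : spread D d * v%:R <= (d / 2) ^+ D * v%:R.
  rewrite ler_wpM2r ?ler0n // /spread ler_pdivrMr; last first.
    by rewrite !mulr_gt0 ?ltr0n ?expn_gt0.
  rewrite ler_peMr ?(ltW dD0) // -!natrM ler1n.
  by rewrite !muln_gt0 D0 expn_gt0.
(* The atypical vertices take a quarter and all other exclusions less than half of the
   candidates. *)
have room' : D%:R * ((2 ^ D)%:R * (spread D d * v%:R)) +
    (a + b + D * (D * b) + D * e + D * D * e)%:R < (d / 2) ^+ D * v%:R.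
  have -> : D%:R * ((2 ^ D)%:R * (spread D d * v%:R)) = (d / 2) ^+ D / 4 * v%:R.
    by rewrite -spreadE // !mulrA.
  have lew : (d0 / 2) ^+ D / 2 * w%:R <= (d / 2) ^+ D / 2 * v%:R.
    apply: ler_pM; rewrite ?ler_nat ?divr_ge0 ?exprn_ge0 ?divr_ge0 ?(ltW d00) //.
    rewrite ler_wpM2r ?invr_ge0 // lerXn2r ?nnegrE ?divr_ge0 ?(ltW d00) ?(ltW d_gt0) //.
    by rewrite ler_wpM2r ?invr_ge0.
  have pos : 0 < (d / 2) ^+ D * v%:R by rewrite mulr_gt0.
  by move: pos (lt_le_trans room lew); clear; lra.
have G0 : (0 < #|G|)%N.
  by apply: leq_trans MG; rewrite muln_gt0 M0.
have Ha : ((D * q).+1 * (#|H| + b).+1 <= a)%N.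
  by apply: leq_trans Na; rewrite leq_mul2l ltnS leq_add2r HN orbT.
have [f [P [W pT]]] := partial_complete (giC i) (gig i) degH chiP bd d01 few_bad
  few_reach (ltW (spread0 d d_gt0)) xi_small room' G0 Ha.
exists (Ordinal ir), (subdivision_map f P); split.
  exact: subdivision_map_inj q0 pT.
move=> x y xy; have /andP[-> /eqP col_i] := subdivision_map_adj q0 (giC i) pT xy.
by split=> //; apply: val_inj.
Qed.

(** * Tail bounds for G(n,p) *)

Lemma sum_powerset_prod (R : comPzSemiRingType) (I : finType) (A : {set I}) (f g : I -> R) :
  \sum_(E in powerset A) \prod_(e in A) (if e \in E then f e else g e) =
  \prod_(e in A) (f e + g e).
Proof.
(* Expanding a product over all of [I] gives every subset; [F] vanishes outside [A], which leaves
   the subsets of [A]. *)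
pose F i := if i \in A then f i else 0; pose G i := if i \in A then g i else 1.
have -> : \prod_(e in A) (f e + g e) = \prod_i (F i + G i).
  rewrite big_mkcond; apply: eq_bigr => i _; rewrite /F /G.
  by case: ifP => // _; rewrite add0r.
rewrite bigA_distr big_mkcond [RHS]big_mkcond; apply: eq_bigr => J _ /=.
rewrite powersetE; case: ifPn => [/subsetP sJ|/subsetPn[i iJ iA]].
  rewrite big_mkcond; apply: eq_bigr => i _; rewrite /F /G.
  by case: ifPn => // iA; rewrite (contraNF (sJ i) iA).
by rewrite (bigD1 i) //= iJ /F (negbTE iA) mul0r.
Qed.

Section Gnp.
Variables (R : realType) (n : nat) (p : R).
Hypothesis p01 : 0 <= p <= 1.
Implicit Types (E Q : {set {set 'I_n}}) (X Y S : {set 'I_n}).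
Implicit Types (B : pred {set {set 'I_n}}).

Let weight E : R := \prod_(e in vertex_pairs n) (if e \in E then p else 1 - p).

Definition gnp_mass B : R := \sum_(E in powerset (vertex_pairs n) | B E) weight E.

Lemma gnp_probE (A : sgraph -> Prop) :
  gnp_prob n p A = gnp_mass (fun E => `[< A (graph_of_edges E) >]).
Proof. by []. Qed.

Lemma weight_ge0 E : 0 <= weight E.
Proof.
by apply: prodr_ge0 => e _; case/andP: p01 => p0 p1; case: ifP; rewrite ?subr_ge0.
Qed.

Lemma gnp_massT : \sum_(E in powerset (vertex_pairs n)) weight E = 1.
Proof.
rewrite sum_powerset_prod big1 // => e _; ring.
Qed.

Lemma gnp_mass_ge0 B : 0 <= gnp_mass B.
Proof. by apply: sumr_ge0 => E _; apply: weight_ge0. Qed.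

Lemma gnp_massC B : gnp_mass B = 1 - gnp_mass (predC B).
Proof. by rewrite -gnp_massT (bigID B) /= addrK. Qed.

Lemma gnp_mass_union (I : finType) (J : {set I}) B (Bi : I -> pred {set {set 'I_n}}) (u : R) :
  (forall E, E \subset vertex_pairs n -> B E -> exists2 i, i \in J & Bi i E) ->
  (forall i, i \in J -> gnp_mass (Bi i) <= u) ->
  gnp_mass B <= #|J|%:R * u.
Proof.
move=> cover bound; apply: le_trans (_ : \sum_(i in J) gnp_mass (Bi i) <= _); last first.
  by rewrite mulr_natl -[leRHS]sumr_const; apply: ler_sum.
rewrite /gnp_mass big_mkcondr /=; under [leRHS]eq_bigr do rewrite big_mkcondr /=.
rewrite exchange_big /=; apply: ler_sum => E; rewrite powersetE => sE.
have pos i : 0 <= (if Bi i E then weight E else 0) by case: ifP => // _; apply: weight_ge0.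
case: ifP => [/(cover E sE)[i iJ BiE]|_]; last by apply: sumr_ge0.
by rewrite (bigD1 i) //= BiE lerDl sumr_ge0.
Qed.

Lemma gnp_massS B B' :
  (forall E, E \subset vertex_pairs n -> B E -> B' E) -> gnp_mass B <= gnp_mass B'.
Proof.
move=> sB; rewrite /gnp_mass big_mkcondr [leRHS]big_mkcondr /=.
apply: ler_sum => E; rewrite powersetE => sE; case: ifP => [/(sB E sE) -> //|_].
by case: ifP => // _; apply: weight_ge0.
Qed.

Lemma gnp_massU B B' : gnp_mass (predU B B') <= gnp_mass B + gnp_mass B'.
Proof.
rewrite /gnp_mass !big_mkcondr -big_split /=; apply: ler_sum => E _.
by case: (B E); case: (B' E); rewrite /= ?addr0 ?add0r // lerDl weight_ge0.
Qed.

(** By independence the sum factors over pairs: a pair of [Q] contributes [1 + (lam - 1) * p], at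
    most the exponential of [(lam - 1) * p], and any other pair contributes 1. *)
Lemma gnp_exp_moment Q (lam : R) : 0 <= lam -> Q \subset vertex_pairs n ->
  \sum_(E in powerset (vertex_pairs n)) lam ^+ #|E :&: Q| * weight E <=
  expR ((lam - 1) * p * #|Q|%:R).
Proof.
move=> lam0 sQ; have [p0 p1] := andP p01.
pose f e := p * (if e \in Q then lam else 1).
have -> : \sum_(E in powerset (vertex_pairs n)) lam ^+ #|E :&: Q| * weight E =
    \sum_(E in powerset (vertex_pairs n))
      \prod_(e in vertex_pairs n) (if e \in E then f e else 1 - p).
  apply: eq_bigr => E; rewrite powersetE => sE.
  have -> : lam ^+ #|E :&: Q| =
      \prod_(e in vertex_pairs n) (if e \in E :&: Q then lam else 1).
    rewrite -big_mkcondr -prodr_const; apply: eq_bigl => e; rewrite inE.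
    by case eE: (e \in E) => //=; rewrite ?andbF // (subsetP sE).
  rewrite /weight -big_split /=; apply: eq_bigr => e _; rewrite inE /f.
  by case: (e \in E); case: (e \in Q); rewrite /= ?mul1r ?mulr1 // mulrC.
rewrite sum_powerset_prod (big_setID Q) /= (setIidPr sQ).
rewrite [X in _ * X]big1 ?mulr1; last first.
  by move=> e; rewrite /f inE => /andP[/negbTE -> _]; ring.
apply: le_trans (_ : \prod_(e in Q) expR ((lam - 1) * p) <= _).
  apply: ler_prod => e eQ; rewrite /f eQ; apply/andP; split.
    by rewrite addr_ge0 ?mulr_ge0 // subr_ge0.
  by apply: le_trans (expR_ge1Dx _); rewrite le_eqVlt; apply/orP; left; apply/eqP; ring.
by rewrite prodr_const -expRM_natr.
Qed.

(* Chernoff's bound; negative values of s give the lower tail. *)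
Lemma gnp_tail Q (s a : R) : Q \subset vertex_pairs n ->
  gnp_mass (fun E => a <= s * #|E :&: Q|%:R) <=
  expR (- a + (expR s - 1) * p * #|Q|%:R).
Proof.
move=> sQ; rewrite expRD.
apply: le_trans (_ : expR (- a) * \sum_(E in powerset (vertex_pairs n))
    expR s ^+ #|E :&: Q| * weight E <= _); last first.
  by rewrite ler_wpM2l ?expR_ge0 // gnp_exp_moment // expR_ge0.
rewrite big_distrr /= /gnp_mass big_mkcondr /=; apply: ler_sum => E _.
case: ifP => [aE|_]; last first.
  by rewrite !mulr_ge0 ?exprn_ge0 ?expR_ge0 ?weight_ge0.
rewrite mulrA -{1}[weight E]mul1r ler_wpM2r ?weight_ge0 // -expRM_natr -expRD.
by rewrite -[leLHS]expR0 ler_expR addrC subr_ge0.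
Qed.

Definition pairs_between X Y : {set {set 'I_n}} :=
  [set e in vertex_pairs n | [exists x in X, exists y in Y, e == [set x; y]]].

Lemma pairs_between_sub X Y : pairs_between X Y \subset vertex_pairs n.
Proof. by apply/subsetP => e; rewrite inE => /andP[]. Qed.

Lemma card_pairs_between X Y : (#|pairs_between X Y| <= #|X| * #|Y|)%N.
Proof.
rewrite -cardsX; pose h (xy : 'I_n * 'I_n) := [set xy.1; xy.2].
apply: leq_trans (leq_imset_card h _); apply/subset_leq_card/subsetP => e.
rewrite inE => /andP[_ /exists_inP[x xX /exists_inP[y yY /eqP ->]]].
by apply/imsetP; exists (x, y); rewrite // inE xX.
Qed.

Lemma edges_card (T : finType) (g : rel T) (X Y : {set T}) :
  edges g X Y = #|[set xy in setX X Y | g xy.1 xy.2]|.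
Proof.
rewrite edgesE pair_big /= -sum1_card big_mkcond [RHS]big_mkcond /=.
by apply: eq_bigr => -[x y] _; rewrite !inE /=; case: (_ && _); case: (g x y).
Qed.

Lemma set2_inj_ord (x y x' y' : 'I_n) :
  (x < y)%N -> (x' < y')%N -> [set x; y] = [set x'; y'] -> x = x' /\ y = y'.
Proof.
move=> xy xy' e.
have xI : x \in [set x'; y'] by rewrite -e set21.
have yI : y \in [set x'; y'] by rewrite -e set22.
move: xI yI; rewrite !inE => /orP[]/eqP ex /orP[]/eqP ey; move: xy xy'; rewrite ex ey.
- by rewrite ltnn.
- by [].
- by move=> h1 h2; have := ltn_trans h1 h2; rewrite ltnn.
- by rewrite ltnn.
Qed.

(** An unordered pair comes from at most two ordered ones, one increasing and one decreasing. *)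
Lemma edges_le_pairs E X Y : E \subset vertex_pairs n ->
  (edges (edge_adj E) X Y <= 2 * #|E :&: pairs_between X Y|)%N.
Proof.
move=> sE; rewrite edges_card.
set P := [set xy in setX X Y | _]; pose h (xy : 'I_n * 'I_n) := [set xy.1; xy.2].
pose P1 := [set xy in P | (xy.1 < xy.2)%N]; pose P2 := [set xy in P | (xy.2 < xy.1)%N].
have hP xy : xy \in P -> h xy \in E :&: pairs_between X Y.
  case: xy => x y; rewrite !inE /= => /andP[/andP[xX yY] /andP[xy exy]].
  rewrite exy /= cards2 xy /=; apply/exists_inP; exists x => //.
  by apply/exists_inP; exists y.
have cP1 : (#|P1| <= #|E :&: pairs_between X Y|)%N.
  rewrite -(card_in_imset (f := h)).
    by apply/subset_leq_card/subsetP => e /imsetP[xy]; rewrite inE => /andP[/hP ? _] ->.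
  move=> [x y] [x' y']; rewrite !inE /= => /andP[_ xy] /andP[_ xy'] /(set2_inj_ord xy xy').
  by case=> -> ->.
have cP2 : (#|P2| <= #|E :&: pairs_between X Y|)%N.
  rewrite -(card_in_imset (f := h)).
    by apply/subset_leq_card/subsetP => e /imsetP[xy]; rewrite inE => /andP[/hP ? _] ->.
  move=> [x y] [x' y']; rewrite !inE /= => /andP[_ xy] /andP[_ xy'].
  by rewrite /h /= setUC [RHS]setUC => /(set2_inj_ord xy xy')[-> ->].
have sP : P \subset P1 :|: P2.
  apply/subsetP => xy xyP; rewrite in_setU [xy \in P1]inE [xy \in P2]inE xyP /= -neq_ltn.
  by move: xyP; rewrite inE => /andP[_ /andP[xy' _]].
apply: leq_trans (subset_leq_card sP) _; apply: leq_trans (leq_card_setU _ _) _.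
by rewrite mul2n -addnn leq_add.
Qed.

Lemma pairs_le_edges E S :
  (#|E :&: [set e : {set 'I_n} | e \subset S & #|e| == 2]| <= edges (edge_adj E) S S)%N.
Proof.
rewrite edges_card; pose h (xy : 'I_n * 'I_n) := [set xy.1; xy.2].
apply: leq_trans (leq_imset_card h _); apply/subset_leq_card/subsetP => e.
rewrite !inE => /andP[eE /andP[eS /cards2P[x [y [xy ee]]]]].
apply/imsetP; exists (x, y); last by [].
by move: eS eE; rewrite ee subUset !sub1set !inE /= /edge_adj => /andP[-> ->] ->; rewrite xy.
Qed.

Lemma ln2_bounds : 2^-1 <= ln (2 : R) <= 1.
Proof.
have e2 : expR (ln 2) = 2 :> R by rewrite lnK // posrE.
rewrite -[X in X && _]ler_expR -[X in _ && X]ler_expR e2; apply/andP; split; last first.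
  by apply: le_trans (expR_ge1Dx 1); lra.
have h := expR_ge1Dx (- 2^-1 : R); rewrite expRN in h.
have := expR_gt0 (2^-1 : R); set z := expR _ in h * => z0.
rewrite -(ler_pM2r z0) mulVf ?gt_eqF // in h; lra.
Qed.

(** Chernoff's bound with [s = ln 2]: more than [12 * p * M] ordered pairs mean more than
    [6 * p * M] edges, and the exponent is at most [- 3 * p * M + p * M]. *)
Lemma gnp_upper_tail X Y (M : R) : #|X|%:R * #|Y|%:R <= M ->
  gnp_mass (fun E => 12 * p * M < (edges (edge_adj E) X Y)%:R) <=
  expR (- (2 * p * M)).
Proof.
move=> XYM; have [p0 p1] := andP p01; have /andP[l1 l2] := ln2_bounds.
have M0 : 0 <= M by apply: le_trans XYM; rewrite mulr_ge0.
apply: le_trans (gnp_massS _ : _ <= gnp_mass (fun E =>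
   ln 2 * (6 * p * M) <= ln 2 * #|E :&: pairs_between X Y|%:R)) _.
  move=> E sE eE; rewrite ler_wpM2l //; first lra.
  have := edges_le_pairs X Y sE; rewrite -(ler_nat R) natrM => le2.
  by move: (lt_le_trans eE le2); clear; lra.
apply: le_trans (gnp_tail _ _ (pairs_between_sub X Y)) _.
rewrite ler_expR lnK ?posrE //.
have pQ : p * #|pairs_between X Y|%:R <= p * M.
  rewrite ler_wpM2l //; apply: le_trans XYM; rewrite -natrM ler_nat.
  exact: card_pairs_between.
have : 2^-1 * (6 * (p * M)) <= ln 2 * (6 * (p * M)).
  by rewrite ler_wpM2r // !mulr_ge0.
by move: pQ; clear; lra.
Qed.

(** Chernoff's bound with [s = - ln 2]: six vertices ensure at least [5/12 * #|S|^2] pairs, and 1/8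
    - 5/24 = -1/12. *)
Lemma gnp_lower_tail S : (6 <= #|S|)%N ->
  gnp_mass (fun E => (edges (edge_adj E) S S)%:R < p * #|S|%:R ^+ 2 / 8) <=
  expR (- (p * #|S|%:R ^+ 2 / 12)).
Proof.
move=> S6; have [p0 p1] := andP p01; have /andP[l1 l2] := ln2_bounds.
pose Q : {set {set 'I_n}} := [set e : {set 'I_n} | e \subset S & #|e| == 2].
have sQ : Q \subset vertex_pairs n by apply/subsetP => e; rewrite !inE => /andP[].
have cQ : 5 * #|S|%:R ^+ 2 <= 12 * #|Q|%:R :> R.
  rewrite /Q cards_draws -natrX -!natrM ler_nat.
  have : (2 * 'C(#|S|, 2) = #|S| * #|S|.-1)%N by rewrite mul_bin_left bin1 subn1 mulnC.
  by move: S6; case: #|S| => // s; set C := 'C(_, _); rewrite /= expnS expn1; clear; nia.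
apply: le_trans (gnp_massS _ : _ <= gnp_mass (fun E =>
   - (p * #|S|%:R ^+ 2 / 8) <= - ln 2 * #|E :&: Q|%:R)) _.
  move=> E sE eE; rewrite mulNr lerN2.
  apply: le_trans (_ : #|E :&: Q|%:R <= _); first by rewrite ler_piMl.
  by apply: le_trans (ltW eE); rewrite ler_nat pairs_le_edges.
apply: le_trans (gnp_tail _ _ sQ) _.
rewrite ler_expR expRN lnK ?posrE //.
have : p * (5 * #|S|%:R ^+ 2) <= p * (12 * #|Q|%:R) by rewrite ler_wpM2l.
by clear; lra.
Qed.

End Gnp.

(** Allows the union bound over sets of at most [y] vertices to run over functions, of which there
    are [n ^ y]. *)
Lemma set_as_image (T : finType) (Y : {set T}) (y : nat) :
  Y != set0 -> (#|Y| <= y)%N -> exists f : {ffun 'I_y -> T}, Y = [set f i | i : 'I_y].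
Proof.
move=> /set0Pn[z zY] cY; exists [ffun i : 'I_y => nth z (enum Y) i].
apply/setP => x; apply/idP/imsetP => [xY|[i _ ->]].
  have ix : (index x (enum Y) < y)%N.
    by apply: leq_trans cY; rewrite cardE index_mem mem_enum.
  by exists (Ordinal ix); rewrite // ffunE /= nth_index // mem_enum.
rewrite ffunE; case: (ltnP i (size (enum Y))) => iY.
  by rewrite -(mem_enum Y) mem_nth.
by rewrite nth_default.
Qed.

(** * Union bounds over sets of vertices *)

Section GnpUnion.
Variables (R : realType) (n : nat) (p : R).
Hypothesis p01 : 0 <= p <= 1.

Lemma gnp_dense (w : nat) : (6 <= w)%N ->
  gnp_mass p (fun E => `[< exists2 S : {set 'I_n}, (w <= #|S|)%N &
     (edges (edge_adj E) S S)%:R < p * #|S|%:R ^+ 2 / 8 >]) <=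
  (2 ^ n)%:R * expR (- (p * w%:R ^+ 2 / 12)).
Proof.
move=> w6; have [p0 _] := andP p01.
have -> : (2 ^ n)%N = #|[set: {set 'I_n}]|.
  by rewrite -powersetT card_powerset cardsT card_ord.
pose Bi (S : {set 'I_n}) : pred {set {set 'I_n}} := fun E => (w <= #|S|)%N &&
  ((edges (edge_adj E) S S)%:R < p * #|S|%:R ^+ 2 / 8).
apply: (gnp_mass_union p01 (Bi := Bi)).
  by move=> E _ /asboolP[S wS eS]; exists S; rewrite ?inE // /Bi wS eS.
move=> S _; case: (leqP w #|S|) => wS; last first.
  rewrite /gnp_mass big_pred0 ?expR_ge0 // => E.
  by rewrite /Bi leqNgt wS andbF.
apply: le_trans (gnp_massS p01 _) (le_trans (gnp_lower_tail p01 (leq_trans w6 wS)) _).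
  by move=> E _ /andP[].
rewrite ler_expR lerN2 ler_wpM2r ?invr_ge0 // ler_wpM2l //.
by rewrite lerXn2r ?nnegrE // ler_nat.
Qed.

(** The slack [z] keeps the exponent at [2 * p * k * z] or more even for tiny [Y], so all [4 ^ n]
    pairs of sets can be treated at once. *)
Lemma gnp_upper (k z : R) : 0 <= k -> 0 <= z ->
  gnp_mass p (fun E => `[< exists X Y : {set 'I_n}, k <= #|X|%:R /\
     12 * p * (#|X|%:R * (#|Y|%:R + z)) < (edges (edge_adj E) X Y)%:R >]) <=
  (4 ^ n)%:R * expR (- (2 * p * (k * z))).
Proof.
move=> k0 z0; have [p0 _] := andP p01.
have -> : (4 ^ n)%N = #|[set: {set 'I_n} * {set 'I_n}]|.
  have c2 : #|[set: {set 'I_n}]| = (2 ^ n)%N.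
    by rewrite -powersetT card_powerset cardsT card_ord.
  rewrite cardsT card_prod -!(cardsT {set 'I_n}) c2 -expnMn //.
pose Bi (XY : {set 'I_n} * {set 'I_n}) : pred {set {set 'I_n}} := fun E =>
  (k <= #|XY.1|%:R) && (12 * p * (#|XY.1|%:R * (#|XY.2|%:R + z)) <
     (edges (edge_adj E) XY.1 XY.2)%:R).
apply: (gnp_mass_union p01 (Bi := Bi)).
  by move=> E _ /asboolP[X [Y [kX eXY]]]; exists (X, Y); rewrite ?inE // /Bi kX eXY.
move=> [X Y] _; case: (leP k #|X|%:R) => kX; last first.
  rewrite /gnp_mass big_pred0 ?expR_ge0 // => E.
  by rewrite /Bi leNgt kX andbF.
have XYM : #|X|%:R * #|Y|%:R <= #|X|%:R * (#|Y|%:R + z) :> R.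
  by rewrite ler_wpM2l // lerDl.
apply: le_trans (gnp_massS p01 _) (le_trans (gnp_upper_tail p01 XYM) _).
  by move=> E _ /andP[].
rewrite ler_expR lerN2 ler_wpM2l ?mulr_ge0 //.
by apply: ler_pM => //; rewrite lerDr.
Qed.

Lemma gnp_max_degree :
  gnp_mass p (fun E => `[< exists x : 'I_n,
     12 * p * n%:R < #|nbrs (edge_adj E) x setT|%:R >]) <=
  n%:R * expR (- (2 * p * n%:R)).
Proof.
have -> : n%:R = #|[set: 'I_n]|%:R :> R by rewrite cardsT card_ord.
pose Bi (x : 'I_n) : pred {set {set 'I_n}} := fun E =>
  12 * p * #|[set: 'I_n]|%:R < (edges (edge_adj E) [set x] setT)%:R.
apply: (gnp_mass_union p01 (Bi := Bi)).
  move=> E _ /asboolP[x ex]; exists x; rewrite ?inE // /Bi.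
  by rewrite /edges big_set1.
move=> x _; apply: (gnp_upper_tail p01).
by rewrite cards1 mul1r.
Qed.

(** A constant [s] in the tail bound does not beat the [n^(x+y)] pairs of sets, so [s] is
    [ln n / (2 * q)]. The gain [4 * m * x * ln n] then exceeds the entropy [3 * m * x * ln n], and
    [small] keeps the moment term below [m * x]. *)
Lemma gnp_expansion (q m x : nat) : (0 < q)%N -> (0 < m)%N -> (0 < x)%N ->
  1 <= ln n%:R :> R -> 2 * (expR (ln n%:R / (2 * q%:R)) * p * x%:R) <= 1 ->
  gnp_mass p (fun E => `[< exists X Y : {set 'I_n},
     [/\ #|X| = x, (#|Y| <= 2 * (m * x))%N &
       16 * q%:R * m%:R * #|X|%:R <= (edges (edge_adj E) X Y)%:R :> R] >]) <=
  expR (1 - ln n%:R).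
Proof.
move=> q0 m0 x0 n1 small; have [p0 _] := andP p01.
pose y := (2 * (m * x))%N; pose s : R := ln n%:R / (2 * q%:R).
have n0 : (0 < n)%N.
  by case: n n1 => // /le_trans; rewrite ln0 // => /(_ 0 (lexx _)); rewrite ler10.
have q0' : 0 < q%:R :> R by rewrite ltr0n.
have s0 : 0 < s by rewrite divr_gt0 ?mulr_gt0 //; apply: lt_le_trans n1.
have es : s * (2 * q%:R) = ln n%:R by rewrite /s divfK // gt_eqF ?mulr_gt0.
pose I := ({ffun 'I_x -> 'I_n} * {ffun 'I_y -> 'I_n})%type.
pose im (l : nat) (f : {ffun 'I_l -> 'I_n}) := [set f i | i : 'I_l].
pose Q (fh : I) := pairs_between (im x fh.1) (im y fh.2).
pose a : R := 8 * q%:R * m%:R * x%:R.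
pose Bi (fh : I) : pred {set {set 'I_n}} := fun E => s * a <= s * #|E :&: Q fh|%:R.
have a0 : 0 < a by rewrite !mulr_gt0 ?ltr0n.
apply: le_trans (_ : #|[set: I]|%:R *
    expR (- (s * a) + (expR s - 1) * p * (x * y)%:R) <= _).
  apply: (gnp_mass_union p01 (Bi := Bi)).
    move=> E sE /asboolP[X [Y [cX cY]]]; rewrite cX => eXY.
    have e0 : (0 < edges (edge_adj E) X Y)%N.
      by rewrite -(ltr0n R); apply: lt_le_trans eXY; rewrite !mulr_gt0 ?ltr0n.
    have X0 : X != set0 by rewrite -card_gt0 cX.
    have Y0 : Y != set0.
      apply: contraTneq e0 => ->; rewrite -leqNgt.
      by apply: leq_trans (edges_leq_mul _ _ _) _; rewrite cards0 muln0.
    have [f ef] := set_as_image X0 (eq_leq cX).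
    have [h eh] := set_as_image Y0 cY.
    exists (f, h); rewrite ?inE // /Bi /Q /im /= -ef -eh ler_wpM2l ?(ltW s0) //.
    have := edges_le_pairs X Y sE; rewrite -(ler_nat R) natrM => le2.
    by move: (le_trans eXY le2); rewrite /a; clear; lra.
  move=> [f h] _; apply: le_trans (gnp_tail p01 _ _ (pairs_between_sub _ _)) _.
  rewrite ler_expR lerD2l ler_wpM2l ?mulr_ge0 //.
    by rewrite subr_ge0 -[leLHS]expR0 ler_expR ltW.
  rewrite ler_nat; apply: leq_trans (card_pairs_between _ _) _.
  by apply: leq_mul; apply: leq_trans (leq_imset_card _ _) _; rewrite card_ord.
rewrite cardsT card_prod !card_ffun !card_ord -expnD natrX.
have -> : n%:R ^+ (x + y) = expR ((x + y)%:R * ln n%:R) :> R.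
  by rewrite mulrC expRM_natr lnK // posrE ltr0n.
rewrite -expRD ler_expR.
have mx1 : 1 <= m%:R * x%:R :> R by rewrite -natrM ler1n muln_gt0 m0.
have sa : s * a = 4 * (m%:R * x%:R) * ln n%:R by rewrite -es /a; ring.
have xy : (x + y)%:R * ln n%:R <= 3 * (m%:R * x%:R) * ln n%:R :> R.
  rewrite ler_wpM2r //; first by apply: le_trans n1.
  rewrite /y -natrM -natrM ler_nat.
  by move: (leq_pmull x m0); clear; lia.
have last_term : (expR s - 1) * p * (x * y)%:R <= m%:R * x%:R.
  apply: le_trans (_ : (2 * (expR s * p * x%:R)) * (m%:R * x%:R) <= _).
    rewrite /y !natrM.
    have -> : 2 * (expR s * p * x%:R) * (m%:R * x%:R) =
      expR s * p * (x%:R * (2 * (m%:R * x%:R))) by ring.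
    by rewrite ler_wpM2r ?mulr_ge0 // ler_wpM2r // gerDl oppr_le0.
  by rewrite ler_piMl // mulr_ge0.
rewrite sa; move: n1 mx1 xy last_term; set L := ln _; set z := m%:R * x%:R.
set u := _ * L; set v := _ * (x * y)%:R => n1 mx1 xy lt1.
have : 0 <= (z - 1) * (L - 1) by rewrite mulr_ge0 // subr_ge0.
by move: xy lt1; clear; lra.
Qed.

End GnpUnion.

(** Double counting: [k] or more vertices with more than [kappa] neighbours in [Y] would exceed the
    upper bound on edges. *)
Lemma few_rich_of_upper (R : realType) (T : finType) (g : rel T) (p k z : R)
    (kappa b y0 : nat) :
  0 < p -> k < b.+1%:R -> 12 * p * (y0%:R + z) < kappa.+1%:R ->
  (forall X Y : {set T}, k <= #|X|%:R ->
     (edges g X Y)%:R <= 12 * p * (#|X|%:R * (#|Y|%:R + z))) ->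
  0 < k ->
  forall Y : {set T}, (#|Y| <= y0)%N ->
  (#|[set v | (kappa < #|nbrs g v Y|)%N]| <= b)%N.
Proof.
move=> p0 kb small upper k0 Y cY; set X := [set v | _].
rewrite -ltnS -(ltr_nat R); apply: le_lt_trans kb; rewrite leNgt; apply/negP => kX.
have X0 : 0 < #|X|%:R :> R by apply: lt_trans kX.
have low : kappa.+1%:R * #|X|%:R <= (edges g X Y)%:R :> R.
  by apply: edges_ge_deg => x; rewrite inE ler_nat.
have := le_trans low (upper X Y (ltW kX)).
rewrite (mulrC #|X|%:R) mulrA ler_pM2r // leNgt => /negP; apply.
apply: le_lt_trans small; rewrite ler_wpM2l ?mulr_ge0 ?(ltW p0) //.
by rewrite lerD2r ler_nat.
Qed.

(** The failures are [q.-1] expansion events and four others, whose number [q + 4] rounds up.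
    [gnp_upper] enters at two scales: for the last layer of the paths, and with [k] and [z] for the
    rich vertices. *)
Lemma gnp_prob_ramsey (R : realType) (D q r : nat) :
  (2 <= q)%N -> (0 < D)%N -> (0 < r)%N ->
  exists (M : nat) (d0 : R), [/\ (0 < M)%N, 0 < d0 &
  forall (n : nat) (p k z u : R) (m w a b kappa Delta y0 N : nat),
  let e := (q * (kappa * Delta ^ q.-1))%N in
  (M * w <= n)%N -> 0 < p <= 1 -> (2 <= m)%N -> (6 <= w)%N ->
  1024 * q%:R * r%:R * m%:R <= p * w%:R ->
  4096 * r%:R * m%:R ^+ q.-1 <= w%:R :> R -> 4096 * r%:R <= w%:R :> R ->
  (0 < Delta)%N -> 12 * p * n%:R < Delta.+1%:R ->
  0 < k -> 0 <= z -> k < b.+1%:R -> 12 * p * (y0%:R + z) < kappa.+1%:R ->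
  (a + q * b <= y0)%N -> (q * Delta ^ q.-1 <= a)%N ->
  ((D * q).+1 * (N + b).+1 <= a)%N ->
  (a + b + D * (D * b) + D * e + D * D * e)%:R < (d0 / 2) ^+ D / 2 * w%:R ->
  1 <= ln n%:R :> R ->
  (forall j, (j < q.-1)%N ->
     2 * (expR (ln n%:R / (2 * q%:R)) * p * m%:R ^+ j) <= 1) ->
  expR (1 - ln n%:R) <= u ->
  (2 ^ n)%:R * expR (- (p * w%:R ^+ 2 / 12)) <= u ->
  (4 ^ n)%:R * expR (- (2 * p * (m%:R ^+ q.-1 * (w%:R / (3072 * r%:R))))) <= u ->
  (4 ^ n)%:R * expR (- (2 * p * (k * z))) <= u ->
  n%:R * expR (- (2 * p * n%:R)) <= u ->
  1 - (q + 4)%:R * u <= gnp_prob n p (fun G : sgraph => forall H : sgraph,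
     #|H| = N -> max_degree H = D -> ramsey G (subdivision H q) r)].
Proof.
move=> q2 D0 r0; have [M [d0 [M0 d00 det]]] := @pseudorandom_ramsey R D q r q2 D0 r0.
exists M, d0; split=> // n p k z u m w a b kappa Delta y0 N e.
move=> Mw p01 m2 w6 hm hmq hw Delta0 hDelta k0 z0 kb small ay reach_a Na room ln1 exp1.
move=> u0 u1 u2 u3 u4.
have [p0 p1] := andP p01; have p01' : 0 <= p <= 1 by rewrite ltW.
have w3 : 0 <= w%:R / (3072 * r%:R) :> R by rewrite divr_ge0 ?mulr_ge0 ?ler0n.
have q0 : (0 < q)%N by apply: leq_trans q2.
have m0 : (0 < m)%N by apply: leq_trans m2.
rewrite gnp_probE gnp_massC // lerD2l lerN2.
set A : pred {set {set 'I_n}} := predC _.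
pose B1 (E : {set {set 'I_n}}) := `[< exists2 S : {set 'I_n}, (w <= #|S|)%N &
     (edges (edge_adj E) S S)%:R < p * #|S|%:R ^+ 2 / 8 >].
pose B2 (j : 'I_q.-1) (E : {set {set 'I_n}}) := `[< exists X Y : {set 'I_n},
     [/\ #|X| = (m ^ j)%N, (#|Y| <= 2 * (m * m ^ j))%N &
       16 * q%:R * m%:R * #|X|%:R <= (edges (edge_adj E) X Y)%:R :> R] >].
pose B3 (k z : R) (E : {set {set 'I_n}}) := `[< exists X Y : {set 'I_n}, k <= #|X|%:R /\
     12 * p * (#|X|%:R * (#|Y|%:R + z)) < (edges (edge_adj E) X Y)%:R >].
pose B4 (E : {set {set 'I_n}}) := `[< exists x : 'I_n,
     12 * p * n%:R < #|nbrs (edge_adj E) x setT|%:R >].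
pose B3a := B3 (m%:R ^+ q.-1) (w%:R / (3072 * r%:R)).
pose B2U (E : {set {set 'I_n}}) := [exists j, B2 j E].
have cover (E : {set {set 'I_n}}) : E \subset vertex_pairs n -> A E ->
    predU B1 (predU B2U (predU B3a (predU (B3 k z) B4))) E.
  move=> _ AE; rewrite -[predU _ _ _]/[|| B1 E, B2U E, B3a E, B3 k z E | B4 E].
  apply: contraTT AE; rewrite 4!negb_or => /and5P[nB1 nB2 nB3a nB3 nB4].
  rewrite negbK; apply/asboolP => H HN HD.
  have degE x : (#|nbrs (edge_adj E) x setT| <= Delta)%N.
    rewrite -ltnS -(ltr_nat R); apply: le_lt_trans hDelta; rewrite leNgt.
    by apply: contra nB4 => ex; apply/asboolP; exists x.
  have rich := few_rich_of_upper p0 kb small _ k0.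
  have {}rich : forall Y : {set 'I_n}, (#|Y| <= y0)%N ->
      (#|[set v | (kappa < #|nbrs (edge_adj E) v Y|)%N]| <= b)%N.
    apply: rich => X Y kX; rewrite leNgt; apply: contra nB3 => eXY.
    by apply/asboolP; exists X, Y.
  apply: (det (graph_of_edges E) p m w a b e N) => //.
  - by rewrite card_ord.
  - move=> S wS; rewrite leNgt; apply: contra nB1 => eS.
    by apply/asboolP; exists S.
  - move=> j X Y jq cX cY; rewrite ltNge; apply: contra nB2 => eXY.
    apply/existsP; exists (Ordinal jq); apply/asboolP; exists X, Y.
    by split; rewrite // -expnS.
  - move=> X Y cX; rewrite leNgt; apply: contra nB3a => eXY.
    by apply/asboolP; exists X, Y; rewrite -natrX -cX; split; rewrite // mulrA.
  - move=> W cW; have Wy : (#|W| + q * b <= y0)%N by apply: leq_trans ay; rewrite leq_add2r.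
    exact (card_bad_le degE rich q0 Wy).
  - by move=> x; apply: leq_trans reach_a; exact (card_reach_le Delta0 degE q x).
  - by rewrite HN.
  - move=> v; rewrite -HD /max_degree; exact: (@leq_bigmax H (@degree H)).
apply: le_trans (gnp_massS p01' cover) _.
have b1 : gnp_mass p B1 <= u by apply: le_trans (gnp_dense n p01' w6) u1.
have b2 : gnp_mass p B2U <= q.-1%:R * u.
  have -> : q.-1 = #|[set: 'I_q.-1]| by rewrite cardsT card_ord.
  apply: (gnp_mass_union p01' (Bi := B2)) => [E _ /existsP[j Bj]|j _].
    by exists j.
  apply: le_trans u0; apply: gnp_expansion => //; rewrite ?expn_gt0 ?m0 //.
  by rewrite natrX exp1.
have b3a : gnp_mass p B3a <= u.
  by apply: le_trans u2; apply: gnp_upper => //; rewrite exprn_ge0.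
have b3 : gnp_mass p (B3 k z) <= u.
  by apply: le_trans u3; apply: gnp_upper => //; rewrite ltW.
have b4 : gnp_mass p B4 <= u by apply: le_trans (gnp_max_degree n p01') u4.
apply: le_trans (gnp_massU p01' _ _) _.
apply: le_trans (lerD b1 (le_trans (gnp_massU p01' _ _) (lerD b2 (le_trans
  (gnp_massU p01' _ _) (lerD b3a (le_trans (gnp_massU p01' _ _) (lerD b3 b4))))))) _.
have uu : 0 <= u by apply: le_trans b1; apply: gnp_mass_ge0.
have : q.-1%:R * u <= q%:R * u by rewrite ler_wpM2r // ler_nat leq_pred.
by rewrite natrD; clear; lra.
Qed.

(** * Choice of the constants *)

Lemma gnp_prob_le1 (R : realType) (n : nat) (p : R) (A : sgraph -> Prop) :
  0 <= p <= 1 -> gnp_prob n p A <= 1.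
Proof.
by move=> p01; rewrite gnp_probE gnp_massC gerBl gnp_mass_ge0.
Qed.

Lemma truncn_near (R : realType) (x : R) : 0 <= x ->
  (Num.truncn x)%:R <= x /\ x < (Num.truncn x)%:R + 1.
Proof. by move=> x0; rewrite natr1; apply/andP; exact: truncn_itv. Qed.

Lemma expn_le_expR (R : realType) (k n : nat) (l : R) : k%:R <= expR l ->
  (k ^ n)%:R <= expR (n%:R * l).
Proof. by move=> kl; rewrite natrX mulrC expRM_natr lerXn2r ?nnegrE ?expR_ge0. Qed.

Lemma nbhs_pinfty_real (R : realType) (x : R) :
  \forall t \near (+oo%R : set_system R), x <= t.
Proof. by apply: nbhs_pinfty_ge; rewrite num_real. Qed.

(* With [t = n ^ (1 / q)] every requirement that n be large becomes a constant
   lower bound on t. *)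
Lemma gnp_prob_ramsey_large (R : realType) (D q r : nat) :
  (0 < D)%N -> (2 <= q)%N -> (0 < r)%N ->
  exists c mu0 : R, [/\ 0 < c, 0 < mu0 &
  \forall t \near (+oo%R : set_system R), forall n : nat, t ^+ q = n%:R ->
  0 <= c * t / n%:R <= 1 /\
  1 - (q + 4)%:R * expR (1 - ln n%:R) <= gnp_prob n (c * t / n%:R) (fun G : sgraph =>
     forall H : sgraph, #|H| = Num.truncn (mu0 * n%:R) -> max_degree H = D ->
     ramsey G (subdivision H q) r)].
Proof.
move=> D0 q2 r0; have [M [d0 [M0 d00 main]]] := @gnp_prob_ramsey R D q r q2 D0 r0.
have Mr : 1 <= M%:R :> R by rewrite ler1n.
have rr : 1 <= r%:R :> R by rewrite ler1n.
have qr : 2 <= q%:R :> R by rewrite (ler_nat R 2).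
have Dr : 1 <= D%:R :> R by rewrite ler1n.
(* Half of 1/M, so that [n %/ M] is at least [rho * n] despite rounding. *)
pose rho : R := (2 * M%:R)^-1.
have rho0 : 0 < rho by rewrite invr_gt0 mulr_gt0 ?ltr0n.
have rhoM : 2 * rho * M%:R = 1 by rewrite /rho; field; rewrite gt_eqF ?ltr0n.
clearbody rho.
(* The layers grow by a factor [m] of about [eps * c * t], while [p * w] is at least
   [c * rho * t]. *)
pose eps : R := rho / (1024 * q%:R * r%:R).
have eps0 : 0 < eps by rewrite divr_gt0 ?mulr_gt0 ?ltr0n // ltnW.
have epsE : 1024 * q%:R * r%:R * eps = rho.
  by rewrite /eps mulrC divfK ?gt_eqF ?mulr_gt0 ?ltr0n // ltnW.
clearbody eps.
(* Once [p * m ^+ q.-1] is at least [C1], the exponent of the last-layer event is at least [3 * n],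
   which beats [4 ^ n] with [n] to spare. *)
pose C1 : R := 4608 * r%:R / rho.
have C10 : 0 < C1 by rewrite divr_gt0 ?mulr_gt0 ?ltr0n.
have C1E : C1 * rho = 4608 * r%:R by rewrite /C1 divfK ?gt_eqF.
clearbody C1.
(* As [m] is at least [eps * t / 2], the second summand gives [p * m ^+ q.-1 >= C1]. The summand [q]
   serves the maximum degree, through [q * ln t <= c * t]. *)
pose c : R := q%:R + (2 / eps) ^+ q.-1 * C1.
have Ceps0 : 0 < (2 / eps) ^+ q.-1 * C1 by rewrite mulr_gt0 ?exprn_gt0 ?divr_gt0.
have cq : q%:R <= c by rewrite lerDl ltW.
have c2 : 2 <= c by apply: le_trans cq.
have c0 : 0 < c by apply: lt_le_trans c2.
have cC : C1 <= c * (eps / 2) ^+ q.-1.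
  have -> : C1 = (2 / eps) ^+ q.-1 * C1 * (eps / 2) ^+ q.-1.
    rewrite mulrAC -exprMn (_ : 2 / eps * (eps / 2) = 1) ?expr1n ?mul1r //.
    by field; rewrite gt_eqF.
  by rewrite ler_wpM2r ?exprn_ge0 ?divr_ge0 ?(ltW eps0) // lerDr.
clearbody c.
pose sig : R := (d0 / 2) ^+ D / 2 * rho.
have sig0 : 0 < sig by rewrite mulr_gt0 ?divr_gt0 ?exprn_gt0 ?divr_gt0.
have sigE : (d0 / 2) ^+ D / 2 * rho = sig by [].
clearbody sig.
(* The threshold [e] is at most [q * eps' * c * (12 * c) ^+ q.-1 * n]; with [eps' = sig / B] this
   gives [96 * D^2 * e <= sig * n]. *)
pose B : R := 8 * D%:R ^+ 2 * q%:R * 12 ^+ q * c ^+ q.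
have B1 : 1 <= B.
  have c1 : 1 <= c by move: c2; clear; lra.
  have q1 : 1 <= q%:R :> R by move: qr; clear; lra.
  have h12 : 1 <= 12 :> R by rewrite (ler_nat R 1).
  have h8 : 1 <= 8 :> R by rewrite (ler_nat R 1).
  have h2 := mulr_ege1 h8 (exprn_ege1 2 Dr).
  exact: mulr_ege1 (mulr_ege1 (mulr_ege1 h2 q1) (exprn_ege1 q h12)) (exprn_ege1 q c1).
have B0 : 0 < B by apply: lt_le_trans B1.
have BE : B = 8 * D%:R ^+ 2 * q%:R * 12 ^+ q * c ^+ q by [].
clearbody B.
pose eps' : R := sig / B.
have eps'0 : 0 < eps' by rewrite divr_gt0.
have eps'B : eps' * B = sig by rewrite /eps' divfK // gt_eqF.
clearbody eps'.
(* With [y0] and [z] at most [eta * n], [12 * p * (y0 + z)] is at most [eps' * c * t], whose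
   truncation is [kappa]. *)
pose eta : R := eps' / 24.
have eta0 : 0 < eta by rewrite divr_gt0.
have eta_sig : 2 * eta <= sig.
  have : eps' <= sig by rewrite -eps'B ler_peMr // ltW.
  by move: eps'0; rewrite /eta; clear; lra.
have etaE : 24 * eta = eps' by rewrite /eta; field.
clearbody eta.
pose Dq : R := (D * q).+1%:R.
have Dq0 : 0 < Dq by rewrite ltr0n.
(* The used set may have about [eta / 2 * n] vertices; the branch vertices of H and their paths
   claim half of that. *)
pose mu0 : R := eta / (4 * Dq).
have mu00 : 0 < mu0 by rewrite divr_gt0 ?mulr_gt0.
have muE : 4 * Dq * mu0 = eta by rewrite /mu0 mulrC divfK // gt_eqF ?mulr_gt0.
clearbody mu0.
(* With [k = K * s] and [z = eta * n] the exponent [2 * p * k * z] is exactly [3 * n]. *)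
pose K : R := 3 / (2 * eta) / c.
have K0 : 0 < K by rewrite !divr_gt0 ?mulr_gt0.
have KE : 2 * c * K * eta = 3 by rewrite /K; field; rewrite !gt_eqF.
clearbody K.
exists c, mu0; split=> //.
pose E1 : R := (eps * c) ^+ q.-1.
have E10 : 0 < E1 by rewrite exprn_gt0 ?mulr_gt0.
pose E2 : R := (12 * c) ^+ q.-1.
have E20 : 0 < E2 by rewrite exprn_gt0 ?mulr_gt0.
have BE2 : B = 96 * D%:R ^+ 2 * q%:R * c * E2.
  have eq12 : (12 * c) ^+ q = 12 * c * E2 by rewrite /E2 -exprS prednK // ltnW.
  by rewrite BE -mulrA -exprMn eq12; ring.
have E1def : E1 = (eps * c) ^+ q.-1 by [].
have E2def : E2 = (12 * c) ^+ q.-1 by [].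
clearbody E1 E2.
near=> t => n tn; set p := c * t / n%:R.
have T1 : 2 / (eps * c) <= t by near: t; exact: nbhs_pinfty_real.
have T2 : 4096 * r%:R * E1 / rho <= t by near: t; exact: nbhs_pinfty_real.
have T3 : 4096 * r%:R / rho <= t by near: t; exact: nbhs_pinfty_real.
have T4 : 2 * M%:R <= t by near: t; exact: nbhs_pinfty_real.
have T5 : q%:R * K / (eta / 2) <= t by near: t; exact: nbhs_pinfty_real.
have T6 : q%:R * E2 / (eta / 2) <= t by near: t; exact: nbhs_pinfty_real.
have T7 : Dq * (K + 1) / (eta / 4) <= t by near: t; exact: nbhs_pinfty_real.
have T8 : (1 + D%:R ^+ 2) * K / (sig / 4) <= t by near: t; exact: nbhs_pinfty_real.
have T9 : expR 1 <= t by near: t; exact: nbhs_pinfty_real.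
have T10 : (4 * E1 / eps) ^+ 2 <= t by near: t; exact: nbhs_pinfty_real.
have T11 : 24 / (c * rho ^+ 2) <= t by near: t; exact: nbhs_pinfty_real.
have T12 : c <= t by near: t; exact: nbhs_pinfty_real.
have t1 : 1 <= t by move: c2 T12; clear; lra.
have t0 : 0 < t by apply: lt_le_trans t1.
pose s : R := t ^+ q.-1.
have ts : t * s = n%:R by rewrite -tn /s -exprS prednK // ltnW.
have s_t : t <= s by rewrite /s -[leLHS]expr1 ler_weXn2l // -ltnS prednK // ltnW.
have s1 : 1 <= s by apply: le_trans s_t.
have s0 : 0 < s by apply: lt_le_trans s1.
have epsm (x : R) : (x * t) ^+ q.-1 = x ^+ q.-1 * s by rewrite exprMn.
clearbody s.
have n0 : 0 < n%:R :> R by rewrite -ts mulr_gt0.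
have n1 : t <= n%:R by rewrite -ts ler_peMr // ltW.
have lift (x y : R) : 0 < y -> x / y <= t -> x * s <= y * n%:R.
  by move=> y0; rewrite ler_pdivrMr // -ts => xy; rewrite mulrA (mulrC y) ler_pM2r.
have pE : p * s = c by rewrite /p -ts; field; rewrite !gt_eqF.
have p0 : 0 < p by rewrite divr_gt0 ?mulr_gt0.
have pn : p * n%:R = c * t by rewrite /p divfK // gt_eqF.
clearbody p.
have p1 : p <= 1.
  rewrite -(ler_pM2r s0) pE mul1r; exact: le_trans T12 s_t.
have p01 : 0 < p <= 1 by rewrite p0.
split; first by rewrite ltW.
pose w := (n %/ M)%N.
have wn : rho * n%:R <= w%:R.
  have : n%:R < (w%:R + 1) * M%:R :> R.
    by rewrite natr1 -natrM ltr_nat ltn_ceil.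
  have M0' : 0 < M%:R :> R by rewrite ltr0n.
  have : rho * n%:R * M%:R <= w%:R * M%:R -> rho * n%:R <= w%:R by rewrite ler_pM2r.
  move=> h lt; apply: h; have -> : rho * n%:R * M%:R = (2 * rho * M%:R) * n%:R / 2 by field.
  by rewrite rhoM; move: lt (le_trans T4 n1); clear; lra.
have Mw : (M * w <= n)%N by rewrite mulnC leq_trunc_div.
clearbody w.
have [m_le m_gt] := @truncn_near R (eps * c * t) (ltW (mulr_gt0 (mulr_gt0 eps0 c0) t0)).
pose m := Num.truncn (eps * c * t); rewrite -/m in m_le m_gt.
have ect2 : 2 <= eps * c * t by move: T1; rewrite ler_pdivrMr ?mulr_gt0 // mulrC.
have m_half : eps * c * t / 2 <= m%:R by move: m_gt ect2; clear; lra.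
have m2 : (2 <= m)%N.
  by rewrite /m truncn_ge_nat // ltW // !mulr_gt0.
have m0 : 0 < m%:R :> R by rewrite ltr0n ltnW.
have mE1 : m%:R ^+ q.-1 <= E1 * s.
  by rewrite E1def -epsm lerXn2r ?nnegrE ?(ltW m0) // !mulr_ge0 // ltW.
have k1_0 : 0 < K * s by rewrite mulr_gt0.
have [b_le b_gt] := @truncn_near R (K * s) (ltW k1_0).
pose b := Num.truncn (K * s); rewrite -/b in b_le b_gt.
have [y_le y_gt] := @truncn_near R (eta * n%:R) (ltW (mulr_gt0 eta0 n0)).
pose y0 := Num.truncn (eta * n%:R); rewrite -/y0 in y_le y_gt.
have eta2 : 0 < eta / 2 by rewrite divr_gt0.
have [a_le a_gt] := @truncn_near R (eta / 2 * n%:R) (ltW (mulr_gt0 eta2 n0)).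
pose a := Num.truncn (eta / 2 * n%:R); rewrite -/a in a_le a_gt.
have [k_le k_gt] := @truncn_near R (eps' * c * t) (ltW (mulr_gt0 (mulr_gt0 eps'0 c0) t0)).
pose kappa := Num.truncn (eps' * c * t); rewrite -/kappa in k_le k_gt.
have ct0 : 0 < 12 * c * t by rewrite !mulr_gt0.
have [d_le d_gt] := @truncn_near R (12 * c * t) (ltW ct0).
pose Delta := Num.truncn (12 * c * t); rewrite -/Delta in d_le d_gt.
have [N_le _] := @truncn_near R (mu0 * n%:R) (ltW (mulr_gt0 mu00 n0)).
pose N := Num.truncn (mu0 * n%:R); rewrite -/N in N_le *.
have Delta0 : (0 < Delta)%N.
  rewrite -(ltr_nat R); have : 1 <= c * t by apply: mulr_ege1 => //; move: c2; clear; lra.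
  by move: d_gt; clear; lra.
clearbody m b y0 a kappa Delta N.
have dE2 : Delta%:R ^+ q.-1 <= E2 * s.
  by rewrite E2def -epsm lerXn2r ?nnegrE ?ler0n ?(ltW ct0).
have n_ln : expR (ln n%:R) = n%:R :> R by rewrite lnK // posrE.
have ln_n1 : 1 <= ln n%:R :> R.
  by rewrite -ler_expR n_ln; apply: le_trans T9 n1.
have ln_t : ln n%:R = q%:R * ln t :> R by rewrite -tn lnXn // mulr_natl.
have ln_le (x : R) : 0 < x -> ln x <= x.
  by move=> x0; rewrite -ler_expR lnK ?posrE //; apply: le_trans (expR_ge1Dx x); rewrite lerDr.
have e2 : 2 <= expR 1 :> R by apply: le_trans (expR_ge1Dx 1).
have pw : c * rho * t <= p * w%:R.
  apply: le_trans (_ : p * (rho * n%:R) <= _); last by rewrite ler_pM2l.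
  by rewrite mulrCA pn; clear; lra.
have sqt : expR (ln n%:R / (2 * q%:R)) ^+ 2 = t :> R.
  rewrite -expRM_natr ln_t (_ : q%:R * ln t / (2 * q%:R) * 2%:R = ln t).
    by rewrite lnK // posrE.
  by field; rewrite gt_eqF // ltr0n ltnW.
have pm_low : C1 <= p * m%:R ^+ q.-1.
  apply: le_trans cC _.
  have -> : c * (eps / 2) ^+ q.-1 = p * ((eps / 2) ^+ q.-1 * s) by rewrite mulrCA pE mulrC.
  rewrite -epsm ler_pM2l // lerXn2r ?nnegrE ?(ltW m0) //.
    by rewrite !mulr_ge0 ?invr_ge0 // ltW.
  apply: le_trans m_half; have : 0 <= (c - 1) * (eps * t).
    by rewrite mulr_ge0 ?mulr_ge0 ?ltW // subr_gt0; move: c2; clear; lra.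
  by clear; lra.
apply: (main n p (K * s) (eta * n%:R) (expR (1 - ln n%:R)) m w a b kappa Delta y0 N) => {main}.
- exact: Mw.
- exact: p01.
- exact: m2.
- rewrite -(ler_nat R); apply: le_trans wn; apply: le_trans (_ : 4096 * r%:R <= _).
    by move: rr; clear; lra.
  apply: le_trans (_ : 4096 * r%:R * s <= _); last exact: (lift _ _ rho0 T3).
  have r4 : 0 <= 4096 * r%:R :> R by rewrite mulr_ge0 ?ler0n.
  exact: (ler_peMr r4 s1).
- apply: le_trans pw; rewrite -epsE.
  have : 1024 * q%:R * r%:R * m%:R <= 1024 * q%:R * r%:R * (eps * c * t).
    have pos : 0 <= 1024 * q%:R * r%:R :> R by rewrite !mulr_ge0 ?ler0n.
    exact: (ler_wpM2l pos m_le).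
  by clear; lra.
- apply: le_trans wn; apply: le_trans (lift _ _ rho0 T2).
  have r4 : 0 <= 4096 * r%:R :> R by rewrite mulr_ge0 ?ler0n.
  by rewrite -[leRHS]mulrA; exact: (ler_wpM2l r4 mE1).
- apply: le_trans wn; apply: le_trans (lift _ _ rho0 T3).
  have r4 : 0 <= 4096 * r%:R :> R by rewrite mulr_ge0 ?ler0n.
  exact: (ler_peMr r4 s1).
- exact: Delta0.
- by rewrite -mulrA pn -[X in _ < X]natr1 mulrA.
- exact: k1_0.
- by rewrite ltW // mulr_gt0.
- by rewrite -[X in _ < X]natr1.
- rewrite -[X in _ < X]natr1; apply: le_lt_trans k_gt.
  apply: le_trans (_ : 12 * p * (eta * n%:R + eta * n%:R) <= _).
    by rewrite ler_wpM2l ?lerD2r // mulr_ge0 ?ler0n // ltW.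
  have -> : 12 * p * (eta * n%:R + eta * n%:R) = 24 * eta * (p * n%:R) by ring.
  by rewrite pn etaE mulrA.
- rewrite -ltnS -(ltr_nat R) -[X in _ < X]natr1 natrD natrM; apply: le_lt_trans y_gt.
  have := lift _ _ (divr_gt0 eta0 (ltr0n _ 2)) T5.
  have : q%:R * b%:R <= q%:R * (K * s) by rewrite ler_wpM2l.
  by move: a_le; clear; lra.
- rewrite -ltnS -(ltr_nat R) -[X in _ < X]natr1 natrM natrX; apply: le_lt_trans a_gt.
  apply: le_trans (lift _ _ (divr_gt0 eta0 (ltr0n _ 2)) T6).
  by rewrite -mulrA ler_wpM2l.
- rewrite -ltnS -(ltr_nat R) -[X in _ < X]natr1 natrM -/Dq.
  rewrite -[(N + b).+1%:R]natr1 natrD; apply: le_lt_trans a_gt.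
  have := lift _ _ (divr_gt0 eta0 (ltr0n _ 4)) T7.
  have : Dq * (N%:R + b%:R + 1) <= Dq * (mu0 * n%:R + K * s + s).
    by rewrite ler_pM2l //; move: N_le b_le s1; clear; lra.
  have -> : Dq * (mu0 * n%:R + K * s + s) =
      (4 * Dq * mu0) * n%:R / 4 + Dq * (K + 1) * s by field.
  by rewrite muE; clear; lra.
- have eN : (q * (kappa * Delta ^ q.-1))%:R <= q%:R * (eps' * c * E2 * n%:R) :> R.
    rewrite natrM ler_wpM2l // natrM natrX.
    have -> : eps' * c * E2 * n%:R = (eps' * c * t) * (E2 * s) by rewrite -ts; ring.
    by apply: ler_pM; rewrite ?exprn_ge0.
  move: eN; set e := (q * _)%N => eN; clearbody e.
  have D2 : D%:R <= D%:R ^+ 2 :> R by rewrite ler_eXnr.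
  have De : (D%:R + D%:R ^+ 2) * e%:R <= 2 * D%:R ^+ 2 * e%:R :> R.
    by rewrite ler_wpM2r //; move: D2; clear; lra.
  have De' : 96 * (D%:R ^+ 2 * e%:R) <= sig * n%:R :> R.
    have -> : sig * n%:R = 96 * (D%:R ^+ 2 * (q%:R * (eps' * c * E2 * n%:R))).
      by rewrite -eps'B BE2; ring.
    by rewrite ler_pM2l ?ltr0n // ler_wpM2l // sqr_ge0.
  have Db : (1 + D%:R ^+ 2) * b%:R <= sig / 4 * n%:R.
    apply: le_trans (lift _ _ (divr_gt0 sig0 (ltr0n _ 4)) T8).
    by rewrite -mulrA ler_wpM2l // addr_ge0 ?sqr_ge0.
  have big : sig * n%:R <= (d0 / 2) ^+ D / 2 * w%:R.
    by rewrite -sigE -mulrA ler_wpM2l ?divr_ge0 ?exprn_ge0 ?divr_ge0 // ltW.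
  apply: lt_le_trans big; have pos : 0 < sig * n%:R by rewrite mulr_gt0.
  have a4 : a%:R <= sig * n%:R / 4.
    apply: le_trans a_le _; have : 2 * eta * n%:R <= sig * n%:R by rewrite ler_pM2r.
    by clear; lra.
  rewrite !natrD !natrM; move: De De' Db pos a4; clear; rewrite expr2.
  lra.
- exact: ln_n1.
(* Here [p * m ^+ j.+1] is at most the constant [c * E1], so [p * m ^+ j] is O(1/t), which absorbs
   the exponential factor, the square root of [t]. *)
- move=> j jq; have qj : (j.+1 <= q.-1)%N by [].
  set sq := expR _ in sqt *; have sq0 : 0 < sq by apply: expR_gt0.
  have hE1 : 4 * E1 / eps <= sq.
    by rewrite -(@ler_pXn2r _ 2) ?nnegrE ?sqt // ?divr_ge0 ?mulr_ge0 // ltW.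
  rewrite -(ler_pM2r m0) mul1r; apply: le_trans m_half.
  have pm : p * m%:R ^+ j * m%:R <= c * E1.
    rewrite -mulrA -exprSr; apply: le_trans (_ : p * (E1 * s) <= _).
      rewrite ler_pM2l //; apply: le_trans mE1.
      by rewrite ler_weXn2l // ler1n ltnW.
    by rewrite mulrCA pE mulrC.
  apply: le_trans (_ : 2 * sq * (c * E1) <= _).
    have -> : 2 * (sq * p * m%:R ^+ j) * m%:R = 2 * sq * (p * m%:R ^+ j * m%:R) by ring.
    by rewrite ler_wpM2l // mulr_ge0 // ltW.
  have hE1' : 4 * E1 <= sq * eps by move: hE1; rewrite ler_pdivrMr.
  have : sq * c * (4 * E1) <= sq * c * (sq * eps) by rewrite ler_wpM2l ?mulr_ge0 // ltW.
  by rewrite -sqt expr2; clear; lra.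
- by [].
- have h := expn_le_expR n e2; rewrite mulr1 in h.
  apply: le_trans (ler_wpM2r (expR_ge0 _) h) _; rewrite -expRD ler_expR.
  have w1 : c * rho * t * (rho * n%:R) <= p * w%:R * w%:R.
    by apply: ler_pM; rewrite ?mulr_ge0 // ltW.
  have t24 : 24 <= c * rho ^+ 2 * t.
    by move: T11; rewrite ler_pdivrMr ?mulr_gt0 ?exprn_gt0 // mulrC.
  have : 24 * n%:R <= c * rho ^+ 2 * t * n%:R by rewrite ler_pM2r.
  by move: w1 (ln_le _ n0); rewrite !expr2; clear; lra.
- have h4 : 4 <= expR 2 :> R.
    have -> : 2 = 1 + 1 :> R by []; rewrite expRD.
    by have := ler_pM (ler0n _ 2) (ler0n _ 2) e2 e2; clear; lra.
  have h := expn_le_expR n h4.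
  apply: le_trans (ler_wpM2r (expR_ge0 _) h) _; rewrite -expRD ler_expR.
  have pmw : C1 * (rho * n%:R) <= p * m%:R ^+ q.-1 * w%:R.
    by apply: ler_pM => //; rewrite ?mulr_ge0 // ltW.
  have key : 3 * n%:R <= 2 * p * (m%:R ^+ q.-1 * (w%:R / (3072 * r%:R))).
    have r3 : 0 < 3072 * r%:R :> R by move: rr; clear; lra.
    have -> : 2 * p * (m%:R ^+ q.-1 * (w%:R / (3072 * r%:R))) =
      2 * (p * m%:R ^+ q.-1 * w%:R) / (3072 * r%:R).
      by rewrite !mulrA.
    rewrite ler_pdivlMr //; move: pmw; rewrite mulrA C1E; clear; lra.
  by move: key (ln_le _ n0); clear; lra.
- have h4 : 4 <= expR 2 :> R.
    have -> : 2 = 1 + 1 :> R by []; rewrite expRD.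
    by have := ler_pM (ler0n _ 2) (ler0n _ 2) e2 e2; clear; lra.
  have h := expn_le_expR n h4.
  apply: le_trans (ler_wpM2r (expR_ge0 _) h) _; rewrite -expRD ler_expR.
  have -> : 2 * p * (K * s * (eta * n%:R)) = 2 * (p * s) * K * eta * n%:R by ring.
  by rewrite pE KE; move: (ln_le _ n0); clear; lra.
- rewrite -[X in X * _]n_ln -expRD ler_expR -mulrA pn ln_t.
  have : q%:R * ln t <= c * t.
    apply: le_trans (_ : q%:R * t <= _); last by rewrite ler_pM2r.
    by rewrite ler_wpM2l // ln_le.
  by clear; lra.
Unshelve. all: by end_near.
Qed.

Local Open Scope classical_set_scope.
Local Open Scope ring_scope.

Lemma near_natr_ge (R : realType) (x : R) : \forall n \near \oo, x <= n%:R.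
Proof.
have [L _ xL] := natr_bound x.
by exists L => // n /= Ln; apply: le_trans xL _; rewrite ler_nat.
Qed.

Theorem theorem1p1 (R : realType) (D q r : nat)
    (hD : (2 <= D)%N) (hq : (2 <= q)%N) (hr : (2 <= r)%N) :
  exists c mu0 : R, 0 < c /\ 0 < mu0 /\
    gnp_prob n (c * n%:R `^ (-1 + 1 / q%:R))
      (fun G : sgraph =>
         forall H : sgraph,
           #|H| = Num.truncn (mu0 * n%:R) ->
           max_degree H = D ->
           ramsey G (subdivision H q) r)
      @[n --> \oo] --> (1 : R).
Proof.
have [c [mu0 [c0 mu00 [T [_ large]]]]] :=
  @gnp_prob_ramsey_large R D q r (ltnW hD) hq (ltnW hr).
exists c, mu0; split=> //; split=> //.
apply/cvgrPdist_le => e e0; near=> n.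
have n1 : 1 <= n%:R :> R by near: n; exact: near_natr_ge.
have n0 : 0 < n%:R :> R by apply: lt_le_trans n1.
have q0 : q%:R != 0 :> R by rewrite pnatr_eq0 -lt0n ltnW.
pose t : R := n%:R `^ (1 / q%:R).
have t0 : 0 <= t by exact: powR_ge0.
have tq : t ^+ q = n%:R.
  by rewrite -powR_mulrn // /t -powRrM divfK // powRr1 // ltW.
have Tt : T < t.
  apply: le_lt_trans (ler_norm T) _.
  rewrite -(@ltr_pXn2r _ q) ?nnegrE ?normr_ge0 // ?(ltnW hq) // tq.
  apply: lt_le_trans (_ : `|T| ^+ q + 1 <= _); first by rewrite ltrDl.
  by near: n; exact: near_natr_ge.
have [p01 low] := large t Tt n tq.
have -> : c * n%:R `^ (-1 + 1 / q%:R) = c * t / n%:R.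
  have n_neq0 : n%:R != 0 :> R by rewrite gt_eqF.
  rewrite powRD ?n_neq0 ?implybT //  powR_inv1 ?(ltW n0) // -/t; ring.
have up := @gnp_prob_le1 R n _ (fun G : sgraph => forall H : sgraph,
  #|H| = Num.truncn (mu0 * n%:R) -> max_degree H = D ->
  ramsey G (subdivision H q) r) p01.
rewrite ger0_norm ?subr_ge0 // lerBlDl -lerBlDr.
apply: le_trans low; rewrite lerD2l lerN2.
(* The failure bound is [(q + 4) * expR 1 / n]. *)
rewrite expRD expRN lnK ?posrE // mulrA ler_pdivrMr // mulrC -ler_pdivrMl //.
by near: n; exact: near_natr_ge.
Unshelve. all: by end_near.
Qed.
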